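(* Suppose that $M$ is a Hölder continuous function on $\Sigma_A$ taking values in the set of positive $d\times d$ matrices (all entries strictly positive). For $\alpha\in\mathbb{R}$ let $$E(\alpha)=\Big\{x\in\Sigma_A:\ \lim_{n\to\infty}\frac{\log\|M(x)M(\sigma x)\cdots M(\sigma^{n-1}x)\|}{n}=\alpha\Big\}.$$ Then for any $\alpha=P'(q)$ with $q\in\mathbb{R}$, $q\ne 0$, $$\dim_H E(\alpha)=\frac{1}{\log m}\big(-\alpha q+P(q)\big),$$ where $\dim_H$ denotes the Hausdorff dimension.
   Context: Let $m\ge 2$, $\Sigma=\{1,\dots,m\}^{\mathbb{N}}$, with the left shift $\sigma$ and the metric $d(x,y)=m^{-n}$ for $x\neq y$, where $n$ is the smallest $k$ with $x_k\ne y_k$; Hausdorff dimension is taken with respect to this metric. Let $A$ be an $m\times m$ matrix with entries $0$ or $1$, assumed primitive (some power $A^p$ has all entries strictly positive). $\Sigma_A=\{x\in\Sigma: A_{x_k,x_{k+1}}=1\ \text{for all } k\}$ is the associated subshift of finite type. $\Sigma_{A,n}$ is the set of admissible words $J=j_1\cdots j_n$ of length $n$ over $\{1,\dots,m\}$ (that is, $A_{j_k,j_{k+1}}=1$ for $1\le k<n$), and $[J]=\{x\in\Sigma_A: x_i=j_i,\ 1\le i\le n\}$ is the cylinder set. The matrix norm is $\|B\|=\mathbf{1}^tB\mathbf{1}$ with $\mathbf{1}^t=(1,\dots,1)$ (the sum of all entries). The pressure function of $M$ is $$P(q)=\lim_{n\to\infty}\frac1n\log\sum_{J\in\Sigma_{A,n}}\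 \sup_{x\in[J]}\|M(x)M(\sigma x)\cdots M(\sigma^{n-1}x)\|^q,$$ the limit existing for every $q\in\mathbb{R}$ in this setting; $P$ is differentiable at every $q\neq0$. *)

(* Defs.v *)
From HB Require Import structures.
From mathcomp Require Import all_boot all_order all_algebra.
From mathcomp Require Import all_classical all_reals all_analysis.

Set Implicit Arguments.
Unset Strict Implicit.
Unset Printing Implicit Defensive.

Import Order.TTheory GRing.Theory Num.Theory.
Import numFieldNormedType.Exports.

Local Open Scope classical_set_scope.
Local Open Scope ring_scope.

(* * Hausdorff dimension in a metric space *)

Section hausdorff.
Context {R : realType} {T : metricType R}.
Implicit Types (E U : set T) (s delta : R).

(* [diam set0 = -oo] *)
Definition diam U : \bar R :=
  ereal_sup [set (mdist p.1 p.2)%:E | p in U `*` U].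

(* The empty set has weight 0 for every [s], including [s = 0], where all
   nonempty sets have weight 1. *)
Definition hausdorff_weight s U : \bar R :=
  if U == set0 then 0%E else (diam U `^ s)%E.

Definition hausdorff_content s delta E : \bar R :=
  ereal_inf [set (\sum_(0 <= i <oo) hausdorff_weight s (U i))%E
            | U in [set U : (set T)^nat |
                E `<=` \bigcup_i U i /\ forall i, (diam (U i) <= delta%:E)%E]].

Definition hausdorff_measure s E : \bar R :=
  ereal_sup [set hausdorff_content s delta E | delta in [set delta | 0 < delta]].

Definition hausdorff_dim E : \bar R :=
  ereal_inf [set s%:E | s in [set s | 0 <= s /\ hausdorff_measure s E = 0%E]].

End hausdorff.

Definition hoelder_continuous_on (R : realType) (T : metricType R)
    (V : normedZmodType R) (D : set T) (f : T -> V) : Prop :=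
  exists C a : R, 0 < a /\
    forall x y, D x -> D y -> `|f x - f y| <= C * mdist x y `^ a.

(* * The full shift *)

(* Letters and coordinates are numbered from 0: the [k]-th coordinate, [k >= 1],
   of a one-sided sequence [x] is [x k.-1].  The parameter [R] is the
   type in which the distance takes its values. *)
Definition fullshift (R : realType) (m : nat) : Type := nat -> 'I_m.

HB.instance Definition _ (R : realType) (m : nat) :=
  Choice.copy (fullshift R m) (nat -> 'I_m).

Section fullshift_metric.
Context {R : realType} {m : nat}.
Implicit Types x y z : fullshift R m.

(* [(ex_minn h).+1] is the first index of disagreement, counted from 1. *)
Definition fullshift_dist x y : R :=
  if pselect (exists k, x k != y k) is left h then m%:R ^- (ex_minn h).+1
  else 0.

Let m_ge1 x : 1 <= m%:R :> R.
Proof. by rewrite ler1n (leq_ltn_trans _ (ltn_ord (x 0))). Qed.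

Let m_gt0 x : 0 < m%:R :> R.
Proof. exact: lt_le_trans (m_ge1 x). Qed.

Lemma fullshift_dist_ge0 x y : 0 <= fullshift_dist x y.
Proof.
by rewrite /fullshift_dist; case: pselect => // h; rewrite invr_ge0 exprn_ge0.
Qed.

Lemma fullshift_dist_ge x y n :
  x n != y n -> m%:R ^- n.+1 <= fullshift_dist x y.
Proof.
move=> xyn; rewrite /fullshift_dist; case: pselect => [h|]; last first.
  by case; exists n.
case: ex_minnP => k _ /(_ _ xyn) kn.
have m0 := m_gt0 x.
by rewrite lef_pV2 ?posrE ?exprn_gt0// ler_weXn2l// (m_ge1 x).
Qed.

Lemma fullshift_distxx x : fullshift_dist x x = 0.
Proof.
by rewrite /fullshift_dist; case: pselect => // h; have [k /[!eqxx]] := h.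
Qed.

Lemma fullshift_dist_eq0 x y : fullshift_dist x y = 0 -> x = y.
Proof.
move=> d0; apply/funext => k; apply/eqP; apply: contraT => /fullshift_dist_ge.
by rewrite d0 leNgt invr_gt0 exprn_gt0// (m_gt0 x).
Qed.

Let fullshift_dist_sym_le x y : fullshift_dist x y <= fullshift_dist y x.
Proof.
rewrite {1}/fullshift_dist; case: pselect => [h|_]; last first.
  exact: fullshift_dist_ge0.
by case: ex_minnP => k xyk _; apply: fullshift_dist_ge; rewrite eq_sym.
Qed.

Lemma fullshift_dist_sym x y : fullshift_dist x y = fullshift_dist y x.
Proof. by apply/eqP; rewrite eq_le !fullshift_dist_sym_le. Qed.

Lemma fullshift_dist_triangle y x z :
  fullshift_dist x z <= fullshift_dist x y + fullshift_dist y z.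
Proof.
rewrite {1}/fullshift_dist; case: pselect => [h|_]; last first.
  by rewrite addr_ge0 ?fullshift_dist_ge0.
case: ex_minnP => k xzk _; have [xyk|] := eqVneq (x k) (y k).
  rewrite xyk in xzk.
  by rewrite (le_trans (fullshift_dist_ge xzk))// lerDr fullshift_dist_ge0.
by move/fullshift_dist_ge/le_trans; apply; rewrite lerDl fullshift_dist_ge0.
Qed.

HB.instance Definition _ := isMetric.Build R (fullshift R m)
  fullshift_distxx fullshift_dist_eq0 fullshift_dist_sym fullshift_dist_triangle.

Definition shift x : fullshift R m := fun k => x k.+1.

End fullshift_metric.

(* * Subshifts of finite type *)

Definition zero_one_mx (m : nat) (A : 'M[nat]_m) : Prop :=
  forall i j, A i j = 0%N \/ A i j = 1%N.

Definition primitive_mx (m : nat) (A : 'M[nat]_m) : Prop :=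
  exists p : nat, (0 < p)%N /\ forall i j, (0 < (A ^+ p) i j)%N.

Section subshift.
Context {R : realType} {m : nat} (A : 'M[nat]_m).

Definition subshift : set (fullshift R m) :=
  [set x | forall k, A (x k) (x k.+1) = 1%N].

Definition admissible (J : seq 'I_m) : bool :=
  sorted (fun a b => A a b == 1%N) J.

Definition cylinder n (J : n.-tuple 'I_m) : set (fullshift R m) :=
  [set x | subshift x /\ forall i : 'I_n, x i = tnth J i].

End subshift.

(* * Products of matrices along the shift *)

Definition mxnorm_sum (R : realType) (d : nat) (B : 'M[R]_d) : R :=
  \sum_i \sum_j B i j.

Section matrix_products.
Context {R : realType} {m d : nat}.
Variables (A : 'M[nat]_m) (M : fullshift R m -> 'M[R]_d).

Definition cocycle (n : nat) (x : fullshift R m) : 'M[R]_d :=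
  \prod_(k < n) M (iter k shift x).

Definition pressure (q : R) : R :=
  lim ((n%:R^-1 *
        ln (\sum_(J : n.-tuple 'I_m | admissible A J)
              sup [set mxnorm_sum (cocycle n x) `^ q | x in cylinder A J]))
       @[n --> \oo]).

Definition level_set (alpha : R) : set (fullshift R m) :=
  [set x | subshift A x /\
     ln (mxnorm_sum (cocycle n x)) / n%:R @[n --> \oo] --> alpha].

End matrix_products.

(* Main.v *)
Require Import Defs.
From mathcomp Require Import all_boot all_order all_algebra.
From mathcomp Require Import all_classical all_reals all_analysis.
From mathcomp Require Import lra ring.

(** The logarithm of the norm of a product of positive matrices is additive up
    to a bounded error.  Indeed the entries of the matrices lie in a compact
    subinterval of the positive reals, so that all columns of a product have
    comparable sums and the norm is multiplicative up to a constant; and by the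
    Hoelder condition the norm of the product of length n changes by a bounded
    factor between two points that agree on their first n coordinates.  The
    problem is thereby reduced to a function L on admissible words with
    |L(uv) - L(u) - L(v)| <= kappa (cocycle_potential), the level set becomes
    the set of points x with L(x|n)/n --> alpha, and P(t) is the exponential
    growth rate of S_n(t), the sum of exp(t L(w)) over the words of length n.

    Primitivity lets one join any two words by a word of fixed length, which
    makes log S_n(t) almost additive; hence S_n(t) = exp(n P(t)) up to a
    constant factor (partition_sum_growth).

    Upper bound.  Points of the level set have, at every large length n, a
    prefix w with |L(w) - n alpha| <= n eps.  There are at most
    exp(n (P(q) - alpha q + |q| eps)) such words up to a constant factor,
    because each of them contributes at least exp(n (q alpha - |q| eps)) to
    S_n(q).  Covering by their cylinders gives the upper bound
    (null_measure_above).

    Lower bound.  A Gibbs measure would give the cylinder of w the mass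
    exp(q L(w) - |w| P(q)) up to constants, would be carried by the level set
    because P is differentiable at q, and would satisfy the hypothesis of the
    mass distribution principle.  The proof works instead with a function nu on
    words that satisfies the Gibbs upper bound, the inequality nu(w) <= sum of
    the nu(wa) over the letters a, and nu > 0 on the empty word; an upper limit
    of normalised partition sums has these properties (gibbs_subadditive).  If a
    family of words has total nu-mass smaller than that of the empty word, then
    some infinite sequence has no prefix in the family (avoid_costly_words): one
    descends letter by letter, always keeping the mass of the current word above
    the mass of the members of the family that extend it.  This is applied to
    the union of two families.  The first consists of the words that violate
    |L(w) - |w| alpha| <= eps |w|; comparing weights at q with weights at q + t
    and q - t for small t shows that their mass at length n decays
    exponentially (deviation_bound).  The second encodes an arbitrary cover of
    the level set; for words outside the first family
    nu(w) <= K exp(- sigma |w|) whenever sigma < P(q) - alpha q, so its mass is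
    controlled by the Hausdorff sum of the cover.  A sequence that avoids both
    lies in the level set and is not covered (covering_bound), so covers with
    small Hausdorff sum do not exist. *)

Set Implicit Arguments.
Unset Strict Implicit.
Unset Printing Implicit Defensive.

Import Order.TTheory GRing.Theory Num.Theory.
Import numFieldNormedType.Exports.

Local Open Scope classical_set_scope.
Local Open Scope ring_scope.

(** * Words and infinite sequences *)

Lemma big_tuple0 (S : Type) (idx : S) (op : Monoid.com_law idx) (T : finType)
    (F : seq T -> S) :
  \big[op/idx]_(J : 0.-tuple T) F J = F [::].
Proof.
rewrite (big_pred1 [tuple])// => J; rewrite /= tuple0; exact/esym/eqxx.
Qed.

Lemma big_tupleS (S : Type) (idx : S) (op : Monoid.com_law idx) (T : finType)
    n (F : seq T -> S) :
  \big[op/idx]_(J : n.+1.-tuple T) F J =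
  \big[op/idx]_(a : T) \big[op/idx]_(J : n.-tuple T) F (a :: J).
Proof.
rewrite pair_bigA/=.
rewrite (reindex (fun p : T * n.-tuple T => [tuple of p.1 :: p.2]))//=.
exists (fun t : n.+1.-tuple T => (thead t, [tuple of behead t])).
  by move=> [a J] _ /=; rewrite theadE; congr pair; apply: val_inj.
by move=> t _; rewrite /= [t in RHS]tuple_eta.
Qed.

Lemma big_tuple_rcons (S : Type) (idx : S) (op : Monoid.com_law idx)
    (T : finType) (w : seq T) n (F : seq T -> S) :
  \big[op/idx]_(J : n.+1.-tuple T) F (w ++ J) =
  \big[op/idx]_(a : T) \big[op/idx]_(J : n.-tuple T) F (rcons w a ++ J).
Proof.
rewrite (big_tupleS _ _ (fun s => F (w ++ s))).
by apply: eq_bigr => a _; apply: eq_bigr => J _; rewrite cat_rcons.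
Qed.

Lemma big_tupleD (S : Type) (idx : S) (op : Monoid.com_law idx) (T : finType)
    n k (F : seq T -> S) :
  \big[op/idx]_(J : (n + k).-tuple T) F J =
  \big[op/idx]_(u : n.-tuple T) \big[op/idx]_(v : k.-tuple T) F (u ++ v).
Proof.
elim: n F => [|n ih] F.
  by rewrite (big_tuple0 _ (fun u => \big[op/idx]_(v : k.-tuple T) F (u ++ v))).
rewrite addSn big_tupleS.
rewrite (big_tupleS _ _ (fun u => \big[op/idx]_(v : k.-tuple T) F (u ++ v))).
by apply: eq_bigr => a _; exact: (ih (fun s => F (a :: s))).
Qed.

(** Dependent choice along a tree.  It replaces compactness of the sequence
    space, both in the mass distribution argument and for the lower bound on
    matrix entries. *)
Lemma infinite_branch (T : Type) (P : seq T -> Prop) :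
  P [::] -> (forall w, P w -> exists a, P (rcons w a)) ->
  exists x : nat -> T, forall n, P (mkseq x n).
Proof.
move=> P0 PS.
have [f fP] : exists f : {w | P w} -> T, forall w, P (rcons (sval w) (f w)).
  have := choice (fun w : {w | P w} => PS (sval w) (svalP w)).
  by case=> f fP; exists f.
pose g (w : {w | P w}) : {w | P w} := exist P _ (fP w).
pose w n := iter n g (exist P _ P0).
exists (fun n => f (w n)) => n.
suff -> : mkseq (fun n => f (w n)) n = sval (w n) by exact: svalP.
by elim: n => // n ih; rewrite mkseqS ih /w iterS.
Qed.

Lemma subshift_mkseq (R : realType) m (A : 'M[nat]_m) (x : fullshift R m) :
  (forall n, admissible A (mkseq x n)) <-> subshift A x.
Proof.
split=> [xA k|xA n].
  have /(sortedP (x 0)) := xA k.+2.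
  rewrite size_mkseq => /(_ k (ltnSn _)).
  by rewrite !nth_mkseq// => /eqP.
apply/(sortedP (x 0)) => i; rewrite size_mkseq => ni.
by rewrite !nth_mkseq ?(ltnW ni)//; apply/eqP/xA.
Qed.

(** * Costs on words *)

Section cost.
Local Open Scope ereal_scope.
Context {R : realType} {T : finType}.
Implicit Types (c : seq T -> \bar R) (w : seq T).

Definition total_cost c : \bar R :=
  \sum_(0 <= n <oo) \sum_(J : n.-tuple T) c J.

(** The words that extend [w] are [w] itself and the extensions of the words
    [rcons w a]. *)
Lemma total_cost_rcons c w : (forall v, 0 <= c v) ->
  total_cost (fun v => c (w ++ v)) =
  c w + \sum_(a : T) total_cost (fun v => c (rcons w a ++ v)).
Proof.
move=> c0; rewrite /total_cost nneseries_recl//; last first.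
  by move=> k _; apply: sume_ge0.
rewrite (big_tuple0 _ (fun v => c (w ++ v))) cats0; congr (_ + _).
rewrite -nneseries_addn; last by move=> k; apply: sume_ge0.
rewrite -nneseries_sum; last by move=> a n _; apply: sume_ge0.
by apply: eq_eseriesr => n _; rewrite addn1 big_tuple_rcons.
Qed.

(** A mass distribution principle on the tree of words.  Let [g w] be the total
    cost of the extensions of [w].  Since [g w] is at least the sum of the
    [g (rcons w a)] and [nu w] at most the sum of the [nu (rcons w a)], the
    inequality [g w < nu w] passes to some one-letter extension of [w]; along
    the resulting branch [c <= g < nu]. *)
Lemma avoid_costly_words (nu : seq T -> R) c :
  (forall w, 0 <= c w) ->
  (forall w, (nu w <= \sum_(a : T) nu (rcons w a))%R) ->
  total_cost c < (nu [::])%:E ->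
  exists x : nat -> T, forall n, c (mkseq x n) < (nu (mkseq x n))%:E.
Proof.
move=> c0 nuD totc.
pose g w := total_cost (fun v => c (w ++ v)).
have g0 w : 0 <= g w by apply: nneseries_ge0 => k _ _; apply: sume_ge0.
suff [x xP] : exists x : nat -> T, forall n,
    g (mkseq x n) < (nu (mkseq x n))%:E.
  exists x => n; apply: le_lt_trans (xP n).
  by rewrite /g total_cost_rcons// leeDl// sume_ge0// => a _; exact: g0.
apply: (@infinite_branch _ (fun w => g w < (nu w)%:E)) => // w gw.
apply: contrapT => /forallNP noa.
suff: (nu w)%:E <= g w by rewrite leNgt gw.
rewrite /g total_cost_rcons// (@le_trans _ _ (\sum_(a : T) g (rcons w a)))//.
  rewrite (@le_trans _ _ (\sum_(a : T) (nu (rcons w a))%:E))//.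
    by rewrite sumEFin lee_fin.
  by apply: lee_sum => a _; rewrite leNgt; apply/negP/noa.
by rewrite leeDr.
Qed.

Lemma total_costD c c' : (forall w, 0 <= c w) -> (forall w, 0 <= c' w) ->
  total_cost (fun w => c w + c' w) = total_cost c + total_cost c'.
Proof.
move=> c0 c'0; rewrite /total_cost -nneseriesD; last 2 first.
- by move=> n _ _; apply: sume_ge0.
- by move=> n _ _; apply: sume_ge0.
by apply: eq_eseriesr => n _; rewrite big_split.
Qed.

Lemma total_cost_series (c : nat -> seq T -> \bar R) :
  (forall i w, 0 <= c i w) ->
  total_cost (fun w => \sum_(0 <= i <oo) c i w) =
  \sum_(0 <= i <oo) total_cost (c i).
Proof.
move=> c0; rewrite /total_cost nneseries_interchange; last first.
  by move=> i n; apply: sume_ge0.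
by apply: eq_eseriesr => n _; rewrite nneseries_sum.
Qed.

Lemma eseries_delta (a : \bar R) k : 0 <= a ->
  \sum_(0 <= i <oo) (if i == k then a else 0) = a.
Proof.
move=> a0; rewrite (nneseries_split 0 k.+1); last first.
  by move=> i _; case: ifP.
rewrite add0n [X in _ + X]eseries0 ?adde0; last first.
  by move=> i ki _; rewrite gtn_eqF.
rewrite big_nat_recr//= eqxx big1_seq ?add0e// => i /=.
by rewrite mem_index_iota => /andP[_ /ltn_eqF ->].
Qed.

Lemma total_cost_delta (a : \bar R) w : 0 <= a ->
  total_cost (fun v => if v == w then a else 0) = a.
Proof.
move=> a0; rewrite /total_cost -[RHS](eseries_delta (size w) a0).
apply: eq_eseriesr => n _; case: eqP => [->|nw].
  rewrite (bigD1 (in_tuple w))//= eqxx big1 ?adde0// => J /negbTE.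
  by rewrite -val_eqE /= => ->.
rewrite big1// => J _; case: eqP => // Jw.
by case: nw; rewrite -Jw size_tuple.
Qed.

(** Covers are indexed by natural numbers, words by their length and letters;
    this translates between the two. *)
Lemma total_cost_pickle c : (forall w, 0 <= c w) ->
  \sum_(0 <= i <oo) (if @pickle_inv (seq T) i is Some w then c w else 0) =
  total_cost c.
Proof.
move=> c0.
transitivity (total_cost (fun w =>
    \sum_(0 <= i <oo) (if i == pickle w then c w else 0))).
  rewrite total_cost_series; last by move=> i w; case: ifP.
  apply: eq_eseriesr => i _.
  case E : (@pickle_inv (seq T) i) => [w|]; last first.
    rewrite /total_cost eseries0// => n _ _; rewrite big1// => J _.
    by case: eqP => // iJ; rewrite iJ pickleK_inv in E.
  have /= wi := @pickle_invK (seq T) i; rewrite E /= in wi.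
  rewrite -[LHS](total_cost_delta w)//; congr total_cost; apply/funext => v.
  by rewrite -wi (inj_eq (pcan_inj pickleK)) eq_sym; case: eqP => // ->.
rewrite /total_cost; apply: eq_eseriesr => n _; apply: eq_bigr => J _.
exact: eseries_delta.
Qed.
End cost.

(** * Almost additive sequences, upper limits and connecting words *)

(** Splitting a block of length [n * k] into [n]-blocks and into [k]-blocks
    shows [(a n - C) / n <= (a k + C) / k] for all positive [n] and [k], and any
    [P] that separates the two families of numbers will do. *)
Lemma almost_additive_linear (R : realType) (a : nat -> R) (C : R) :
  (forall n k, `|a (n + k)%N - a n - a k| <= C) ->
  exists P : R, forall n, `|a n - n%:R * P| <= C.
Proof.
move=> aD.
have aM n k : `|a (n * k.+1)%N - k.+1%:R * a n| <= k.+1%:R * C.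
  elim: k => [|k ih]; first by rewrite muln1 !mul1r subrr normr0
    (le_trans _ (aD 0%N 0%N)).
  have := aD n (n * k.+1)%N; rewrite -mulnS [k.+2%:R]mulrS.
  move: ih; rewrite !ler_norml => /andP[h1 h2] /andP[h3 h4].
  by apply/andP; split; nra.
have sep n k : (a n.+1 - C) / n.+1%:R <= (a k.+1 + C) / k.+1%:R.
  rewrite ler_pdivrMr// mulrAC ler_pdivlMr//.
  have := aM n.+1 k; have := aM k.+1 n; rewrite mulnC !ler_norml.
  by move=> /andP[h1 h2] /andP[h3 h4]; nra.
pose S := [set (a n.+1 - C) / n.+1%:R | n in [set: nat]].
have Sub k : ubound S ((a k.+1 + C) / k.+1%:R) by move=> _ [n _ <-].
have S0 : S !=set0 by exists ((a 1%N - C) / 1); exists 0%N.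
exists (sup S) => -[|n].
  by have := aD 0%N 0%N; rewrite mul0r subr0 addn0 subrr sub0r normrN.
have h1 : (a n.+1 - C) / n.+1%:R <= sup S.
  by apply: ub_le_sup; [exists ((a n.+1 + C) / n.+1%:R)|exists n].
have h2 : sup S <= (a n.+1 + C) / n.+1%:R by apply: ge_sup.
rewrite ler_pdivrMr// in h1; rewrite ler_pdivlMr// in h2.
by rewrite ler_norml; apply/andP; split; nra.
Qed.

(** The upper limit, in the only form in which it is used below: as the
    infimum of the eventual upper bounds. *)
Lemma limsup_exists (R : realType) (u : nat -> R) (B : R) :
  (forall k, `|u k| <= B) ->
  exists l : R, (forall y, (\forall k \near \oo, u k <= y) -> l <= y) /\
                (forall y, l < y -> \forall k \near \oo, u k <= y).
Proof.
move=> uB; pose Y := [set y | \forall k \near \oo, u k <= y].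
have lbY : has_lbound Y.
  exists (- B) => y [N _ /(_ N (leqnn N)) /= /(le_trans _)]; apply.
  by have := uB N; rewrite ler_norml => /andP[].
have Y0 : Y !=set0.
  by exists B; apply: nearW => k; rewrite (le_trans _ (uB k))// ler_norm.
exists (inf Y); split=> [y Yy|y infy]; first exact: ge_inf.
have [z Yz zy] : exists2 z, Y z & z < y by apply: inf_lt.
by near do apply: (le_trans _ (ltW zy)).
Unshelve. all: by end_near. Qed.

Section connection.
Context {m : nat} (A : 'M[nat]_m).
Let e (a b : 'I_m) := A a b == 1%N.

Lemma positive_entry_path (r : nat) i j : zero_one_mx A ->
  (0 < (A ^+ r.+1) i j)%N -> exists2 w, size w = r & path e i (rcons w j).
Proof.
move=> A01; elim: r i => [|r ih] i.
  rewrite expr1 => Aij; exists [::] => //=; rewrite andbT /e.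
  by case: (A01 i j) Aij => ->.
rewrite exprS mxE lt0n => s0.
have [k] : exists k, A i k * (A ^+ r.+1) k j != 0%N.
  apply: contrapT => /forallNP h; move/negP: s0; apply.
  by rewrite big1// => k _; apply/eqP; have /negP/negPn := h k.
rewrite muln_eq0 negb_or -!lt0n => /andP[Aik /ih[w <- pw]].
exists (k :: w) => //=; rewrite pw andbT /e.
by case: (A01 i k) Aik => ->.
Qed.

(** If [A ^+ r.+1] is positive then a path with [r] interior vertices joins the
    last letter of [u] to the first letter of [v].  The default letter [i0]
    stands for the missing end letter when a word is empty. *)
Lemma primitive_connect (i0 : 'I_m) : zero_one_mx A -> primitive_mx A ->
  exists r : nat, forall u v, admissible A u -> admissible A v ->
    exists2 w, size w = r & admissible A (u ++ w ++ v).
Proof.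
move=> A01 [p [p0 Ap]]; case: p p0 Ap => // r _ Ar; exists r => u v Au Av.
have [w wr] := positive_entry_path A01 (Ar (last i0 u) (head i0 v)).
move=> pw; exists w => //; rewrite /admissible -/e in Au Av *.
have {Av} {}pw : path e (last i0 u) (w ++ v).
  case: v Av pw => [_|b v /= bv]; first by rewrite cats0 rcons_path => /andP[].
  by rewrite -cat_rcons cat_path last_rcons bv andbT.
case: u Au pw => [_|a u /= au] /= pw; first exact: path_sorted pw.
by rewrite cat_path au.
Qed.

End connection.

(** * Pressure and Gibbs weights of an almost additive potential *)

Definition almost_additive_potential (R : realType) m (A : 'M[nat]_m)
    (L : seq 'I_m -> R) (kappa : R) :=
  forall u v, admissible A (u ++ v) -> `|L (u ++ v) - L u - L v| <= kappa.

Section pressure.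
Context {R : realType} {m : nat} (A : 'M[nat]_m) (L : seq 'I_m -> R).
Context (kappa : R) (hL : almost_additive_potential A L kappa).
Implicit Types (u v w : seq 'I_m) (t P C : R).

Definition weight t w : R := if admissible A w then expR (t * L w) else 0.

Definition partition_sum t n : R := \sum_(J : n.-tuple 'I_m) weight t J.

Lemma weight_ge0 t w : 0 <= weight t w.
Proof. by rewrite /weight; case: ifP => // _; rewrite expR_ge0. Qed.

Lemma partition_sum_ge0 t n : 0 <= partition_sum t n.
Proof. by apply: sumr_ge0 => J _; exact: weight_ge0. Qed.

Lemma weight_le_partition_sum t w : weight t w <= partition_sum t (size w).
Proof.
rewrite /partition_sum (bigD1 (in_tuple w))//= lerDl.
by apply: sumr_ge0 => J _; exact: weight_ge0.
Qed.

Lemma admissible_cat u v : admissible A (u ++ v) ->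
  admissible A u /\ admissible A v.
Proof.
rewrite /admissible; case: u => //= a u.
by rewrite cat_path => /andP[-> /path_sorted ->].
Qed.

Lemma scaled_additive t u v : admissible A (u ++ v) ->
  `|t * L (u ++ v) - t * L u - t * L v| <= `|t| * kappa.
Proof.
by move=> /hL uv; rewrite -!mulrBr normrM ler_wpM2l.
Qed.

Lemma weight_cat_le t u v :
  weight t (u ++ v) <= expR (`|t| * kappa) * (weight t u * weight t v).
Proof.
rewrite {1}/weight; case: ifPn => [uv|_]; last first.
  by rewrite !mulr_ge0 ?weight_ge0 ?expR_ge0.
have [Au Av] := admissible_cat uv; rewrite /weight Au Av -!expRD ler_expR.
by have := scaled_additive t uv; rewrite ler_norml => /andP[h1 h2]; lra.
Qed.

Lemma partition_sum_submul t n k : partition_sum t (n + k) <=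
  expR (`|t| * kappa) * (partition_sum t n * partition_sum t k).
Proof.
rewrite /partition_sum big_tupleD mulr_suml mulr_sumr ler_sum// => u _.
by rewrite !mulr_sumr ler_sum// => v _; exact: weight_cat_le.
Qed.

Context (A01 : zero_one_mx A) (hA : primitive_mx A) (i0 : 'I_m).

(** The connecting word changes the potential by a bounded amount, since there
    are finitely many words of length [r]. *)
Lemma weight_connect t : exists r K, 0 < K /\ forall u v,
  weight t u * weight t v <= K * \sum_(w : r.-tuple 'I_m) weight t (u ++ w ++ v).
Proof.
have [r rP] := primitive_connect i0 A01 hA.
pose B := \sum_(w : r.-tuple 'I_m) `|t * L w|.
exists r, (expR (2 * (`|t| * kappa) + B)); split=> [|u v]; first exact: expR_gt0.
have sum0 : 0 <= \sum_(w : r.-tuple 'I_m) weight t (u ++ w ++ v).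
  by apply: sumr_ge0 => w _; exact: weight_ge0.
rewrite {1 2}/weight; case: ifPn => [Au|_]; last first.
  by rewrite mul0r mulr_ge0 ?expR_ge0.
case: ifPn => [Av|_]; last by rewrite mulr0 mulr_ge0 ?expR_ge0.
have [w wr uwv] := rP u v Au Av.
rewrite -expRD.
rewrite (@le_trans _ _ (expR (2 * (`|t| * kappa) + B) * weight t (u ++ w ++ v)))//.
  rewrite /weight uwv -expRD ler_expR.
  have wB : `|t * L w| <= B.
    have ws : size w == r by apply/eqP.
    rewrite /B (bigD1 (Tuple ws))//= lerDl.
    by apply: sumr_ge0.
  have := scaled_additive t uwv.
  have [_ /(scaled_additive t)] := admissible_cat uwv.
  move: wB; rewrite !ler_norml => /andP[h1 h2] /andP[h3 h4] /andP[h5 h6].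
  lra.
rewrite ler_wpM2l ?expR_ge0//.
have ws : size w == r by apply/eqP.
rewrite (bigD1 (Tuple ws))//= lerDl.
by apply: sumr_ge0 => J _; exact: weight_ge0.
Qed.

(** Inserting connecting words bounds [S_n * S_k] by [S_(n + r + k)], and
    submultiplicativity bounds the latter by a constant times [S_(n + k)]. *)
Lemma partition_sum_supmul t : exists2 K, 0 < K &
  forall n k, partition_sum t n * partition_sum t k <= K * partition_sum t (n + k).
Proof.
have [r [K [K0 KP]]] := weight_connect t.
exists (K * (expR (`|t| * kappa) * partition_sum t r) + 1).
  rewrite ltr_wpDl// !mulr_ge0 ?expR_ge0 ?partition_sum_ge0//; exact: ltW.
move=> n k.
rewrite mulrDl mul1r ler_wpDr ?partition_sum_ge0//.
rewrite (@le_trans _ _ (K * partition_sum t (n + (r + k))))//.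
  rewrite /partition_sum big_tupleD mulr_suml mulr_sumr ler_sum// => u _.
  rewrite mulr_sumr.
  rewrite (big_tupleD _ r k (fun s => weight t (u ++ s))) exchange_big/=.
  by rewrite mulr_sumr ler_sum// => v _; exact: KP.
(* Moving the connecting block to the front lets submultiplicativity split
   it off as a constant factor. *)
rewrite addnCA.
apply: le_trans (ler_wpM2l (ltW K0) (partition_sum_submul t r (n + k))) _.
by rewrite !mulrA.
Qed.

Lemma partition_sum_gt0 t n : 0 < partition_sum t n.
Proof.
have gt0 w : admissible A w -> 0 < partition_sum t (size w).
  move=> Aw; apply: lt_le_trans (weight_le_partition_sum t w).
  by rewrite /weight Aw expR_gt0.
have [K K0 KP] := partition_sum_supmul t.
elim: n => [|n ih]; first exact: (gt0 [::]).
have := lt_le_trans (mulr_gt0 ih (gt0 [:: i0] isT)) (KP n _).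
by rewrite pmulr_rgt0//= addn1.
Qed.

Lemma partition_sum_growth t : exists P C, forall n,
  expR (n%:R * P - C) <= partition_sum t n <= expR (n%:R * P + C).
Proof.
have [K K0 KP] := partition_sum_supmul t.
pose a n := ln (partition_sum t n).
have aE n : expR (a n) = partition_sum t n.
  by rewrite /a lnK// posrE partition_sum_gt0.
have aD n k : `|a (n + k)%N - a n - a k| <= `|t| * `|kappa| + `|ln K|.
  rewrite ler_norml; apply/andP; split.
    have : expR (a n + a k) <= expR (ln K + a (n + k)%N).
      by rewrite !expRD !aE lnK ?posrE.
    have := ler_norm (ln K).
    have : 0 <= `|t| * `|kappa| by rewrite mulr_ge0.
    rewrite ler_expR; lra.
  have : expR (a (n + k)%N) <= expR (`|t| * kappa + (a n + a k)).
    by rewrite !expRD !aE partition_sum_submul.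
  have : `|t| * kappa <= `|t| * `|kappa| by rewrite ler_wpM2l// ler_norm.
  have := normr_ge0 (ln K).
  rewrite ler_expR; lra.
have [P aP] := almost_additive_linear aD.
exists P, (`|t| * `|kappa| + `|ln K|) => n.
rewrite -aE !ler_expR; have := aP n; rewrite ler_norml => /andP[h1 h2].
by apply/andP; split; lra.
Qed.

(** The normalised partition sums [T w k] over the extensions of [w] by [k]
    letters satisfy [T w k.+1 = \sum_a T (rcons w a) k], so their upper limit
    [nu w] as [k] grows is subadditive, and it inherits the Gibbs upper bound
    from submultiplicativity.  Upper limits are only subadditive, so [nu] is not
    a measure in general; subadditivity is what the descent in
    [avoid_costly_words] asks for. *)
Lemma gibbs_subadditive t P C :
  (forall n, expR (n%:R * P - C) <= partition_sum t n <= expR (n%:R * P + C)) ->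
  exists (nu : seq 'I_m -> R) (D : R), [/\ 0 < D, 0 < nu [::],
    forall w, nu w <= \sum_(a : 'I_m) nu (rcons w a),
    forall w, nu w <= D &
    forall w, nu w <= D * (weight t w * expR (- ((size w)%:R * P)))].
Proof.
move=> SP.
pose T w k := expR (- ((size w + k)%N%:R * P)) *
  \sum_(J : k.-tuple 'I_m) weight t (w ++ J).
have T0 w k : 0 <= T w k.
  by rewrite mulr_ge0 ?expR_ge0// sumr_ge0// => J _; exact: weight_ge0.
have TS w k : T w k.+1 = \sum_(a : 'I_m) T (rcons w a) k.
  rewrite /T (big_tuple_rcons _ _ _ (weight t)) mulr_sumr.
  by apply: eq_bigr => a _; rewrite size_rcons addSnnS.
pose E := `|t| * kappa + C.
have TG w k : T w k <= expR E * (weight t w * expR (- ((size w)%:R * P))).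
  rewrite /T (@le_trans _ _ (expR (- ((size w + k)%:R * P)) *
    (expR (`|t| * kappa) * (weight t w * expR (k%:R * P + C)))))//.
    rewrite ler_wpM2l ?expR_ge0//.
    rewrite (@le_trans _ _ (expR (`|t| * kappa) *
      (weight t w * partition_sum t k)))//.
      by rewrite !mulr_sumr ler_sum// => J _; exact: weight_cat_le.
    rewrite ler_wpM2l ?expR_ge0// ler_wpM2l ?weight_ge0//.
    by have /andP[] := SP k.
  rewrite [leLHS](_ : _ = weight t w *
    expR (- ((size w + k)%:R * P) + `|t| * kappa + (k%:R * P + C))); last first.
    by rewrite !(expRD (_ + _)) (expRD (- _)); ring.
  rewrite [leRHS](_ : _ = weight t w * expR (E - (size w)%:R * P)); last first.
    by rewrite (expRD E); ring.
  by rewrite ler_wpM2l ?weight_ge0// ler_expR /E natrD; lra.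
have GD w : weight t w * expR (- ((size w)%:R * P)) <= expR C.
  rewrite (@le_trans _ _ (expR ((size w)%:R * P + C) *
      expR (- ((size w)%:R * P))))//.
    rewrite ler_wpM2r ?expR_ge0// (le_trans (weight_le_partition_sum t w))//.
    by have /andP[] := SP (size w).
  by rewrite -expRD ler_expR; lra.
have TB w k : `|T w k| <= expR E * expR C.
  by rewrite ger0_norm// (le_trans (TG w k))// ler_wpM2l ?expR_ge0.
have [nu nuP] := choice (fun w => limsup_exists (TB w)).
have nule w y : (forall k, T w k <= y) -> nu w <= y.
  by move=> h; apply: (nuP w).1; exact: nearW.
exists nu, (Num.max (expR E) (expR E * expR C)); split.
- by rewrite lt_max expR_gt0.
- apply: (@lt_le_trans _ _ (expR (- C))); first exact: expR_gt0.
  rewrite leNgt; apply/negP => nuC.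
  have [N _ /(_ N (leqnn N)) /=] := (nuP [::]).2 _ (midf_lt nuC).1.
  apply/negP; rewrite -ltNge (lt_le_trans (midf_lt nuC).2)//.
  rewrite /T add0n [leRHS](_ : _ = expR (- (N%:R * P)) * partition_sum t N)//.
  rewrite [leLHS](_ : _ = expR (- (N%:R * P)) * expR (N%:R * P - C)).
    by rewrite ler_wpM2l ?expR_ge0//; have /andP[] := SP N.
  by rewrite -expRD addrA addNr add0r.
- move=> w; apply/ler_addgt0Pr => e e0.
  have m0 : 0 < m%:R :> R by rewrite ltr0n (leq_ltn_trans _ (ltn_ord i0)).
  have : \forall k \near \oo, forall a : 'I_m,
      T (rcons w a) k <= nu (rcons w a) + e / m%:R.
    apply: filter_forall => a; apply: (nuP (rcons w a)).2.
    by rewrite ltrDl divr_gt0.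
  move=> [N _ NP]; apply: (nuP w).1; exists N.+1 => // -[//|k] /= Nk.
  rewrite TS (@le_trans _ _ (\sum_(a : 'I_m) (nu (rcons w a) + e / m%:R)))//.
    by apply: ler_sum => a _; exact: (NP k).
  rewrite big_split/= sumr_const card_ord -(mulr_natr (e / m%:R)).
  by rewrite mulfVK// gt_eqF.
- move=> w; apply: nule => k; rewrite (le_trans (TG w k))//.
  by rewrite le_max; apply/orP; right; rewrite ler_wpM2l ?expR_ge0.
- move=> w; apply: nule => k; rewrite (le_trans (TG w k))//.
  by rewrite ler_wpM2r ?mulr_ge0 ?weight_ge0 ?expR_ge0// le_max lexx.
Qed.
End pressure.

(** * Exponential tails, first order expansions and cylinders *)

Section tail.
Local Open Scope ereal_scope.

Lemma geometric_tail (R : realType) (K theta eta : R) :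
  (0 <= K)%R -> (0 < theta)%R -> (0 < eta)%R ->
  exists N, \sum_(N <= n <oo) (K * expR (- (n%:R * theta)))%:E <= eta%:E.
Proof.
move=> K0 theta0 eta0.
pose z := expR (- theta); pose f n := (K * expR (- (n%:R * theta)))%:E.
have z1 : (z < 1)%R by rewrite /z -expR0 ltr_expR oppr_lt0.
have f0 n : 0 <= f n by rewrite lee_fin mulr_ge0// expR_ge0.
have foo : \sum_(0 <= n <oo) f n < +oo.
  apply: (@le_lt_trans _ _ (K / (1 - z))%:E); last exact: ltry.
  apply: lime_le; first exact: is_cvg_nneseries.
  apply: nearW => n; rewrite sumEFin lee_fin.
  rewrite [leLHS](_ : _ = series (geometric K z) n); last first.
    apply: eq_bigr => i _; congr (_ * _)%R.
    by rewrite -mulrN expRM_natl.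
  rewrite geometric_seriesE ?lt_eqF//.
  rewrite ler_pM2r ?invr_gt0 ?subr_gt0// ler_piMr// gerBl exprn_ge0//.
  exact: expR_ge0.
have /fine_cvgP[_ /cvgrPdist_lt/(_ _ eta0)[N _ /(_ N (leqnn N))]] :=
  @nneseries_tail_cvg R f xpredT foo (fun k _ => f0 k).
rewrite /= sub0r normrN => fN; exists N.
rewrite -[leLHS]fineK ?lee_fin; first by rewrite (le_trans (ler_norm _))// ltW.
have fN0 : 0 <= \sum_(N <= k <oo) f k by exact: nneseries_ge0.
rewrite ge0_fin_numE// (le_lt_trans _ foo)//.
by rewrite (nneseries_split 0 N) ?add0n ?leeDr// sume_ge0.
Qed.

Lemma exponential_small (R : realType) (K theta eta : R) :
  (0 <= K)%R -> (0 < theta)%R -> (0 < eta)%R ->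
  exists N, (K * expR (- (N%:R * theta)) <= eta)%R.
Proof.
move=> K0 theta0 eta0; have [N NP] := geometric_tail K0 theta0 eta0.
exists N; rewrite -lee_fin; apply: le_trans NP.
rewrite [leLHS](_ : _ =
    \sum_(N <= i < N.+1) (K * expR (- (i%:R * theta)))%:E); last first.
  by rewrite big_nat1.
by apply: nneseries_lim_ge => i _ _; rewrite lee_fin mulr_ge0// expR_ge0.
Qed.

(** The first half of a Borel-Cantelli argument: if the cost of length [n]
    decays exponentially, discarding short words makes the total cost as small
    as desired. *)
Lemma exponential_tail_cost (R : realType) (T : finType) (c : seq T -> R)
    (K theta eta : R) : (0 < theta)%R -> (0 < eta)%R -> (forall w, 0 <= c w)%R ->
  (forall n, \sum_(J : n.-tuple T) c J <= K * expR (- (n%:R * theta)))%R ->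
  exists N, total_cost (fun w => if (N <= size w)%N then (c w)%:E else 0)
            <= eta%:E.
Proof.
move=> theta0 eta0 c0 cK.
have K0 : (0 <= K)%R.
  have : (0 <= K * expR (- (0%:R * theta)))%R.
    by rewrite (le_trans _ (cK 0%N))// sumr_ge0.
  by rewrite mul0r oppr0 expR0 mulr1.
have [N NP] := geometric_tail K0 theta0 eta0.
exists N; apply: le_trans NP.
rewrite [leRHS]eseries_cond eseries_mkcond; apply: lee_nneseries => n _.
  by rewrite sume_ge0// => J _; case: ifP => // _; rewrite lee_fin.
rewrite /=; case: ifP => Nn.
  under eq_bigr do rewrite size_tuple Nn.
  by rewrite sumEFin lee_fin cK.
by rewrite big1// => J _; rewrite size_tuple Nn.
Qed.

End tail.

(** One common step [t] for the increments to the right and to the left. *)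
Lemma derivative_linear_approx (R : realType) (P : R -> R) (q alpha eps : R) :
  is_derive q 1 P alpha -> 0 < eps ->
  exists2 t, 0 < t & P (q + t) - P q <= t * alpha + t * eps /\
                     P (q - t) - P q <= - t * alpha + t * eps.
Proof.
move=> dP eps0.
have := @ex_derive _ _ _ _ _ _ _ dP.
rewrite /derivable => /cvg_ex[/= l cl].
have la : l = alpha.
  by rewrite -(@derive_val _ _ _ _ _ _ _ dP) /derive; apply/esym/cvg_lim.
rewrite {}la in cl; move/cvgrPdist_le : cl => /(_ _ eps0)[d /= d0 dcl].
have h t : 0 < `|t| < d -> P (q + t) - P q <= t * alpha + `|t| * eps.
  move=> /andP[t0 td]; have tn : t != 0 by rewrite -normr_gt0.
  have /= := dcl t; rewrite sub0r normrN => /(_ td tn).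
  rewrite /GRing.scale/= mulr1 (addrC t) -(ler_pM2l t0) -normrM mulrBr mulVKf//.
  by rewrite ler_norml => /andP[h1 h2]; lra.
have d2 : 0 < d / 2 by rewrite divr_gt0.
have nd2 : `|d / 2| = d / 2 by rewrite gtr0_norm.
have dd2 : d / 2 < d by rewrite ltr_pdivrMr// ltr_pMr// ltr1n.
exists (d / 2) => //; split.
  by have := h (d / 2); rewrite nd2 d2 dd2 => /(_ isT).
by have := h (- (d / 2)); rewrite normrN nd2 d2 dd2 => /(_ isT).
Qed.

Section metric.
Context {R : realType} {m : nat} (m2 : (2 <= m)%N).
Implicit Types (x y : fullshift R m) (w : seq 'I_m).

Definition word_set w : set (fullshift R m) := [set x | mkseq x (size w) = w].

Lemma mkseq_eqP (T : Type) (x y : nat -> T) n :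
  mkseq x n = mkseq y n <-> (forall k, (k < n)%N -> x k = y k).
Proof.
split=> [xy k kn|xy].
  by rewrite -(nth_mkseq (x 0%N) x kn) -(nth_mkseq (x 0%N) y kn) xy.
by apply: (@eq_from_nth _ (x 0%N)); rewrite ?size_mkseq// => i ni;
  rewrite !nth_mkseq// xy.
Qed.

Lemma dist_le_agree x y n : (forall k, (k < n)%N -> x k = y k) ->
  mdist x y <= m%:R ^- n :> R.
Proof.
move=> xy; rewrite /mdist/= /fullshift_dist; case: pselect => [h|_]; last first.
  by rewrite invr_ge0 exprn_ge0.
case: ex_minnP => k xyk _.
have m0 : 0 < m%:R :> R by rewrite ltr0n (leq_trans _ m2).
rewrite lef_pV2 ?posrE ?exprn_gt0// ler_weXn2l//.
  by rewrite ler1n (leq_trans _ m2).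
by rewrite leqW// leqNgt; apply: contra xyk => kn; rewrite xy.
Qed.

Lemma expr_inv_expR n : m%:R ^- n = expR (- (n%:R * ln m%:R)) :> R.
Proof.
have m0 : 0 < m%:R :> R by rewrite ltr0n (leq_trans _ m2).
by rewrite expRN expRM_natl lnK.
Qed.

Lemma expr_inv_powR n (s : R) :
  (m%:R ^- n) `^ s = expR (- (n%:R * (s * ln m%:R))).
Proof. by rewrite expr_inv_expR -expRM; congr expR; ring. Qed.

Lemma diam_word_set w : (diam (word_set w) <= (m%:R ^- size w)%:E)%E.
Proof.
apply: ge_ereal_sup => _ [[x y] [/= xw yw] <-]; rewrite lee_fin.
by apply: dist_le_agree; apply/mkseq_eqP; rewrite xw yw.
Qed.

Lemma diam_ge0 (U : set (fullshift R m)) : U !=set0 -> (0 <= diam U)%E.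
Proof.
move=> [x Ux]; apply: ereal_sup_ubound; exists (x, x) => //=.
by rewrite mdistxx.
Qed.

Lemma weight_word_set s w : 0 <= s ->
  (hausdorff_weight s (word_set w) <= (expR (- ((size w)%:R * (s * ln m%:R))))%:E)%E.
Proof.
move=> s0; rewrite /hausdorff_weight; case: ifPn => [_|/set0P w0].
  by rewrite lee_fin expR_ge0.
rewrite -expr_inv_powR -poweR_EFin; apply: gt0_ler_poweR => //.
- by rewrite in_itv/= diam_ge0//= leey.
- by rewrite in_itv/= leey lee_fin invr_ge0 exprn_ge0.
- exact: diam_word_set.
Qed.

(** In an ultrametric space a set of positive diameter lies in a ball of
    comparable radius: the longest common prefix of the points of [U] determines
    a cylinder that contains [U], at the cost of one factor [m] in the diameter.
    A singleton lies in arbitrarily small cylinders, whence the error [eta]; for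
    [s = 0] the empty word suffices, since a nonempty set has weight 1. *)
Lemma covering_word (U : set (fullshift R m)) (s eta : R) :
  U !=set0 -> 0 <= s -> 0 < eta ->
  exists2 w, U `<=` word_set w &
    ((expR (- ((size w)%:R * (s * ln m%:R))))%:E <=
     (expR (s * ln m%:R))%:E * hausdorff_weight s U + eta%:E)%E.
Proof.
move=> U0; have [x Ux] := U0; rewrite le_eqVlt => /predU1P[<-|s0] eta0.
  exists [::] => //; rewrite mul0r ?mul0r ?mulr0 oppr0 expR0 mul1e /hausdorff_weight.
  case: ifPn => [/eqP E|_]; first by rewrite E in Ux.
  by rewrite poweRe0 leeDl// lee_fin ltW.
have lm : 0 < ln m%:R :> R by rewrite ln_gt0// ltr1n.
have sl : 0 < s * ln m%:R by rewrite mulr_gt0.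
have wU : hausdorff_weight s U = (diam U `^ s)%E.
  by rewrite /hausdorff_weight; case: ifPn => // /eqP E; rewrite E in Ux.
have [[n [y Uy xy]]|] := pselect (exists n, exists2 y, U y & x n != y n).
  have ex : exists n, `[< exists2 y, U y & x n != y n >].
    by exists n; apply/asboolP; exists y.
  (* [k] is the first index at which some point of [U] differs from [x]. *)
  case: (ex_minnP ex) => k /asboolP[z Uz xz] kmin.
  exists (mkseq x k).
    move=> v Uv; rewrite /word_set/= size_mkseq; apply/mkseq_eqP => i ik.
    apply/eqP; apply: contraT; rewrite eq_sym => vi.
    suff : (k <= i)%N by rewrite leqNgt ik.
    by apply: kmin; apply/asboolP; exists v.
  rewrite size_mkseq wU; apply: (@le_trans _ _
    ((expR (s * ln m%:R))%:E * ((m%:R ^- k.+1 : R) `^ s)%R%:E)%E).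
    rewrite expr_inv_powR -EFinM lee_fin -expRD ler_expR [k.+1%:R]mulrS; lra.
  rewrite -[leLHS]adde0; apply: leeD; last by rewrite lee_fin ltW.
  apply: lee_wpmul2l; first by rewrite lee_fin expR_ge0.
  rewrite -poweR_EFin; apply: gt0_ler_poweR; first exact: ltW.
  - by rewrite in_itv/= leey lee_fin invr_ge0 exprn_ge0.
  - by rewrite in_itv/= diam_ge0//= leey.
  apply: le_trans (_ : (mdist x z)%:E <= _)%E.
    by rewrite lee_fin; exact: fullshift_dist_ge.
  by apply: ereal_sup_ubound; exists (x, z).
move=> nex.
have Ux1 : forall y, U y -> forall n, x n = y n.
  move=> y Uy n; apply/eqP; apply: contraT => xy.
  by case: nex; exists n, y.
have [n] := exponential_small ler01 sl eta0; rewrite mul1r => nP.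
exists (mkseq x n).
  move=> y Uy; rewrite /word_set/= size_mkseq; apply/mkseq_eqP => k _.
  exact/esym/Ux1.
rewrite size_mkseq -[leLHS]add0e; apply: leeD; last by rewrite lee_fin.
by rewrite mule_ge0 ?lee_fin ?expR_ge0// wU poweR_ge0.
Qed.

End metric.

(** * Dimension of the points with a given growth rate *)

Lemma cst_div_cvg0 (R : realType) (C : R) : C / n%:R @[n --> \oo] --> 0.
Proof.
apply/cvgrPdist_le => e e0; near=> n.
have n0 : 0 < n%:R :> R by rewrite ltr0n; near: n; exists 1%N.
rewrite sub0r normrN normrM normfV (gtr0_norm n0) ler_pdivrMr//.
rewrite mulrC -ler_pdivrMr//.
by near: n; exact: nbhs_infty_ger.
Unshelve. all: by end_near. Qed.

Section dimension.
Context {R : realType} {m : nat} (m2 : (2 <= m)%N) (A : 'M[nat]_m).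
Context (L : seq 'I_m -> R) (kappa : R) (hL : almost_additive_potential A L kappa).
Context (P : R -> R).
Context (hP : forall t, exists C, forall n,
  expR (n%:R * P t - C) <= partition_sum A L t n <= expR (n%:R * P t + C)).
Context (q alpha : R) (dP : is_derive q 1 P alpha).
Implicit Types (w : seq 'I_m) (x : fullshift R m).

Definition growth_set : set (fullshift R m) := [set x | subshift A x /\
  L (mkseq x n) / n%:R @[n --> \oo] --> alpha].

Definition deviant eps w :=
  eps * (size w)%:R < `|L w - (size w)%:R * alpha|.

Definition gibbs_weight w := weight A L q w * expR (- ((size w)%:R * P q)).

Lemma gibbs_weight_ge0 w : 0 <= gibbs_weight w.
Proof. by rewrite mulr_ge0 ?weight_ge0 ?expR_ge0. Qed.

(** The exponential change of measure that moves the parameter from [q] to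
    [q + t]. *)
Lemma weight_tilt t u w : weight A L (q + t) w * expR (- u) =
  weight A L q w * expR (t * L w - u).
Proof.
rewrite /weight; case: ifP => _; last by rewrite !mul0r.
by rewrite -!expRD; congr expR; ring.
Qed.

(** The exponential Markov inequality.  An upward deviation at length [n] costs
    at most [exp (n (P (q + t) - P q - t alpha - t eps))], and a downward one is
    treated with [- t]; since [alpha] is the derivative of [P] at [q], both
    exponents are at most [- n t eps / 2] for small [t]. *)
Lemma deviation_bound eps : 0 < eps -> exists K theta, 0 < theta /\
  forall n, \sum_(J : n.-tuple 'I_m) (if deviant eps J then gibbs_weight J else 0)
            <= K * expR (- (n%:R * theta)).
Proof.
move=> eps0; have e20 : 0 < eps / 2 by rewrite divr_gt0.
have [t t0 [tp tn]] := derivative_linear_approx dP e20.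
have [C1 hC1] := hP (q + t); have [C2 hC2] := hP (q - t).
exists (expR C1 + expR C2), (t * (eps / 2)); split; first exact: mulr_gt0.
move=> n.
pose u1 := n%:R * (P q + t * (alpha + eps)).
pose u2 := n%:R * (P q - t * (alpha - eps)).
apply: (@le_trans _ _ (partition_sum A L (q + t) n * expR (- u1) +
                       partition_sum A L (q - t) n * expR (- u2))).
  rewrite /partition_sum !mulr_suml -big_split/= ler_sum// => J _.
  rewrite (weight_tilt t u1) (weight_tilt (- t) u2) /deviant/= size_tuple.
  case: ifPn => [|_]; last by rewrite addr_ge0// mulr_ge0 ?expR_ge0 ?weight_ge0.
  rewrite /gibbs_weight size_tuple lter_normr => /orP[dev|dev].
    rewrite ler_wpDr// ?mulr_ge0 ?expR_ge0 ?weight_ge0//.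
    rewrite ler_wpM2l ?weight_ge0// ler_expR /u1.
    by have := ler_wpM2l (ltW t0) (ltW dev); lra.
  rewrite ler_wpDl// ?mulr_ge0 ?expR_ge0 ?weight_ge0//.
  rewrite ler_wpM2l ?weight_ge0// ler_expR /u2.
  by have := ler_wpM2l (ltW t0) (ltW dev); lra.
have n0 : 0 <= n%:R :> R by [].
rewrite mulrDl lerD//.
  apply: le_trans (ler_wpM2r (expR_ge0 _) (andP (hC1 n)).2) _.
  by rewrite -!expRD ler_expR /u1; have := ler_wpM2l n0 tp; lra.
apply: le_trans (ler_wpM2r (expR_ge0 _) (andP (hC2 n)).2) _.
by rewrite -!expRD ler_expR /u2; have := ler_wpM2l n0 tn; lra.
Qed.

(** The Borel-Cantelli step: a single cost function of small total penalises
    the deviations of all sizes, those of size [1 / (j + 1)] from a length [N j]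
    onwards. *)
Lemma summable_deviations (D eta : R) : 0 < D -> 0 < eta ->
  exists c : seq 'I_m -> \bar R, [/\ forall w, (0 <= c w)%E,
    (total_cost c <= eta%:E)%E &
    forall eps, 0 < eps -> exists N, forall w, (N <= size w)%N ->
      (c w < (D * gibbs_weight w)%:E)%E -> ~~ deviant eps w].
Proof.
move=> D0 eta0.
pose d (j : nat) w := if deviant j.+1%:R^-1 w then D * gibbs_weight w else 0.
have d0 j w : 0 <= d j w.
  by rewrite /d; case: ifP => // _; rewrite mulr_ge0 ?gibbs_weight_ge0// ltW.
have dN j : exists N, (total_cost (fun w =>
    if (N <= size w)%N then (d j w)%:E else 0) <= (eta / (2 ^ j.+1)%:R)%:E)%E.
  have [K [theta [theta0 KP]]] := 
    @deviation_bound j.+1%:R^-1 ltac:(by rewrite invr_gt0).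
  apply: (@exponential_tail_cost _ _ _ (D * K) theta) => //.
    by rewrite divr_gt0// ltr0n expn_gt0.
  move=> n; rewrite -mulrA (le_trans _ (ler_wpM2l (ltW D0) (KP n)))// mulr_sumr.
  by apply: ler_sum => J _; rewrite /d; case: ifP => //; rewrite mulr0.
have [N NP] := choice dN.
pose c w := (\sum_(0 <= j <oo) if (N j <= size w)%N then (d j w)%:E else 0)%E.
have t0 j w : (0 <= if (N j <= size w)%N then (d j w)%:E else 0)%E.
  by case: ifP => // _; rewrite lee_fin.
exists c; split.
- by move=> w; apply: nneseries_ge0 => j _ _; exact: t0.
- rewrite /c total_cost_series//; apply: le_trans (epsilon_trick0 _ (ltW eta0)).
  apply: lee_nneseries => // j _ _.
  by rewrite /total_cost; apply: nneseries_ge0 => n _ _; exact: sume_ge0.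
- move=> eps eps0; pose j := Num.truncn eps^-1.
  have jeps : j.+1%:R^-1 < eps.
    rewrite -[ltRHS]invrK ltf_pV2 ?posrE ?invr_gt0//.
    exact: truncnS_gt.
  exists (N j) => w Nw; apply: contraTN => dev; rewrite -leNgt.
  have devj : deviant j.+1%:R^-1 w.
    by rewrite /deviant (le_lt_trans _ dev)// ler_wpM2r// ltW.
  have := @nneseries_lim_ge R
    (fun j => if (N j <= size w)%N then (d j w)%:E else 0%E)
    xpredT 0%N j.+1 (fun j _ _ => t0 j w).
  rewrite big_nat_recr//= Nw {2}/d devj; apply: le_trans.
  by rewrite leeDr// sume_ge0.
Qed.

Lemma typical_in_growth_set x (c : seq 'I_m -> \bar R) (D : R) :
  (forall w, (0 <= c w)%E) ->
  (forall eps, 0 < eps -> exists N, forall w, (N <= size w)%N ->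
      (c w < (D * gibbs_weight w)%:E)%E -> ~~ deviant eps w) ->
  (forall n, (c (mkseq x n) < (D * gibbs_weight (mkseq x n))%:E)%E) ->
  growth_set x.
Proof.
move=> c0 cP xP; split.
  apply/subshift_mkseq => n; have := le_lt_trans (c0 _) (xP n).
  rewrite lte_fin /gibbs_weight /weight; case: ifP => // _.
  by rewrite mul0r mulr0 ltxx.
apply/cvgrPdist_le => eps eps0; have [N NP] := cP eps eps0.
exists (maxn N 1) => //= n /=; rewrite geq_max => /andP[Nn n1].
have n0 : 0 < n%:R :> R by rewrite ltr0n.
have := NP (mkseq x n); rewrite size_mkseq => /(_ Nn (xP n)).
rewrite /deviant size_mkseq -leNgt -normrN opprB => h.
rewrite -(ler_pM2r n0) -[X in _ * X <= _](gtr0_norm n0) -normrM.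
by rewrite mulrBl mulfVK ?gt_eqF// (mulrC alpha).
Qed.

(** The data shared by the nonemptiness of the growth set and the lower bound:
    the penalty on deviations uses up at most half of the available mass. *)
Lemma gibbs_family : exists (nu : seq 'I_m -> R) (D : R) (c : seq 'I_m -> \bar R),
  [/\ 0 < D /\ 0 < nu [::],
      forall w, nu w <= \sum_(a : 'I_m) nu (rcons w a),
      forall w, nu w <= D,
      forall w, nu w <= D * gibbs_weight w &
      [/\ forall w, (0 <= c w)%E, (total_cost c <= (nu [::] / 2)%:E)%E &
        forall eps, 0 < eps -> exists N, forall w, (N <= size w)%N ->
          (c w < (D * gibbs_weight w)%:E)%E -> ~~ deviant eps w]].
Proof.
have i0 : 'I_m by exists 0%N; exact: leq_trans m2.
have [C hC] := hP q.
have [nu [D [D0 nu0 nuD nuD' nug]]] := gibbs_subadditive hL i0 hC.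
have [||c [c0 ctot cP]] := @summable_deviations D (nu [::] / 2) => //.
  by rewrite divr_gt0.
by exists nu, D, c.
Qed.

Lemma growth_set_nonempty : growth_set !=set0.
Proof.
have [nu [D [c [[D0 nu0] nuD _ nug [c0 ctot cP]]]]] := gibbs_family.
have [|x xP] := avoid_costly_words c0 nuD.
  by apply: le_lt_trans ctot _; rewrite lte_fin ltr_pdivrMr// ltr_pMr// ltr1n.
exists x; apply: (typical_in_growth_set c0 cP) => n.
by apply: lt_le_trans (xP n) _; rewrite lee_fin.
Qed.

(** A single point of the growth set contributes [exp (q L (x|n))] to the
    partition sum of length [n]. *)
Lemma entropy_ge0 : alpha * q <= P q.
Proof.
have [x [xA xL]] := growth_set_nonempty; have [C hC] := hP q.
have cv : q * (L (mkseq x n) / n%:R) - C / n%:R @[n --> \oo] --> q * alpha.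
  by rewrite -[X in _ --> X]subr0; apply: cvgB (cst_div_cvg0 C); apply: cvgMr.
rewrite mulrC -(cvg_lim _ cv)//; apply: limr_le.
  by apply/cvg_ex; exists (q * alpha).
exists 1%N => // n /= n1; have n0 : 0 < n%:R :> R by rewrite ltr0n.
rewrite mulrA -mulrBl ler_pdivrMr//.
have := le_trans (weight_le_partition_sum A L q (mkseq x n)) (andP (hC _)).2.
rewrite /weight (subshift_mkseq A x).2// ler_expR size_mkseq; lra.
Qed.

(** A family of cylinders whose Hausdorff sum at exponent [sigma] is small
    misses a point of the growth set.  The words of the family are charged
    [K * exp (- sigma |w|)], which is at least their mass unless they are already
    penalised as deviant. *)
Lemma covering_bound sigma : 0 <= sigma -> sigma < P q - alpha * q ->
  exists2 beta, 0 < beta & forall W : nat -> option (seq 'I_m),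
    (\sum_(0 <= i <oo) (if W i is Some w
        then (expR (- ((size w)%:R * sigma)))%:E else 0) < beta%:E)%E ->
    exists2 x, growth_set x & forall i w, W i = Some w -> ~ word_set w x.
Proof.
move=> sigma0 sigmaP.
have [nu [D [c [[D0 nu0] nuD nuD' nug [c0 ctot cP]]]]] := gibbs_family.
pose eps := (P q - alpha * q - sigma) / (`|q| + 1).
have q1 : 0 < `|q| + 1 by rewrite ltr_wpDl.
have eps0 : 0 < eps by rewrite divr_gt0// subr_gt0.
have qeps : `|q| * eps <= P q - alpha * q - sigma.
  rewrite /eps mulrA ler_pdivrMr// mulrC ler_wpM2l ?subr_ge0 ?ltW//.
  by rewrite ltrDl.
have [N NP] := cP _ eps0.
(* The factor [expR (N%:R * sigma)] takes care of the words shorter than [N]. *)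
pose K := D * expR (N%:R * sigma).
have K0 : 0 < K by rewrite mulr_gt0// expR_gt0.
have cK w : (c w < (nu w)%:E)%E -> nu w <= K * expR (- ((size w)%:R * sigma)).
  move=> cw; have [wN|Nw] := leqP (size w) N.
    rewrite (le_trans (nuD' w))// /K -mulrA ler_peMr ?(ltW D0)//.
    rewrite -expRD -[leLHS]expR0 ler_expR subr_ge0 ler_wpM2r//.
    by rewrite ler_nat.
  have : ~~ deviant eps w.
    by apply: NP; [exact: ltnW|apply: lt_le_trans cw _; rewrite lee_fin].
  rewrite /deviant -leNgt => dev.
  rewrite (le_trans (nug w))// /K -mulrA ler_wpM2l ?(ltW D0)// -expRD.
  have n0 : 0 <= (size w)%:R :> R by [].
  have qdev : q * (L w - (size w)%:R * alpha) <=
      (size w)%:R * (P q - alpha * q - sigma).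
    rewrite (le_trans (ler_norm _))// normrM.
    apply: le_trans (ler_wpM2l (normr_ge0 q) dev) _.
    by rewrite mulrA mulrC ler_wpM2l.
  rewrite /gibbs_weight /weight; case: ifP => _; last first.
    by rewrite mul0r expR_ge0.
  rewrite -expRD ler_expR.
  have : 0 <= N%:R * sigma by rewrite mulr_ge0.
  lra.
exists (nu [::] / (2 * K)); first by rewrite divr_gt0// mulr_gt0.
move=> W Wbeta.
pose a (i : nat) : \bar R := if W i is Some w
        then (expR (- ((size w)%:R * sigma)))%:E else 0%E.
have a0 i : (0 <= a i)%E.
  by rewrite /a; case: (W i) => // w; rewrite lee_fin expR_ge0.
pose c1 i w := if w == odflt [::] (W i) then (K%:E * a i)%E else 0%E.
have Ka0 i : (0 <= K%:E * a i)%E by rewrite mule_ge0// lee_fin ltW.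
have c10 i w : (0 <= c1 i w)%E by rewrite /c1; case: ifP.
pose c2 w := (c w + \sum_(0 <= i <oo) c1 i w)%E.
have s10 w : (0 <= \sum_(0 <= i <oo) c1 i w)%E.
  by apply: nneseries_ge0 => i _ _; exact: c10.
have c20 w : (0 <= c2 w)%E by rewrite /c2 adde_ge0.
have [|x xP] := avoid_costly_words c20 nuD.
  rewrite /c2 total_costD// total_cost_series//.
  rewrite (eq_eseriesr (g := fun i => (K%:E * a i)%E)); last first.
    by move=> i _; rewrite /c1 total_cost_delta.
  rewrite nneseriesZl//.
  rewrite [ltRHS](_ : _ = (nu [::] / 2)%:E + K%:E * (nu [::] / (2 * K))%:E)%E.
    apply: lee_ltD => //.
      rewrite ge0_fin_numE; first by rewrite (le_lt_trans ctot)// ltry.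
      by rewrite /total_cost; apply: nneseries_ge0 => n _ _; exact: sume_ge0.
    by rewrite lte_pmul2l// lte_fin.
  rewrite -EFinM -EFinD; congr (_%:E); field; exact: lt0r_neq0.
have cx n : (c (mkseq x n) < (nu (mkseq x n))%:E)%E.
  by apply: le_lt_trans (xP n); rewrite /c2 leeDl.
exists x.
  apply: (typical_in_growth_set c0 cP) => n.
  by apply: lt_le_trans (cx n) _; rewrite lee_fin.
move=> i w Wi xw; have := xP (size w); rewrite xw; apply/negP; rewrite -leNgt.
apply: (@le_trans _ _ (c1 i w)).
  rewrite /c1 /a Wi eqxx -EFinM lee_fin; apply: cK.
  by have := cx (size w); rewrite xw.
apply: le_trans (_ : \sum_(0 <= i <oo) c1 i w <= _)%E; last by rewrite leeDr.
have := @nneseries_lim_ge R (c1 ^~ w) xpredT 0%N i.+1 (fun j _ _ => c10 j w).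
by rewrite big_nat_recr//=; apply: le_trans; rewrite leeDr// sume_ge0.
Qed.

(** A cover with small Hausdorff sum can be replaced by cylinders
    ([covering_word]) with a sum that is still below the threshold of
    [covering_bound]. *)
Lemma null_measure_bound (s : R) : 0 <= s ->
  hausdorff_measure s growth_set = 0%E -> P q - alpha * q <= s * ln m%:R.
Proof.
move=> s0 Hs; rewrite leNgt; apply/negP => sP.
have lm0 : 0 <= ln m%:R :> R by rewrite ln_ge0// ler1n (leq_trans _ m2).
have sl0 : 0 <= s * ln m%:R by rewrite mulr_ge0.
have [beta beta0 betaP] := covering_bound sl0 sP.
pose K := expR (s * ln m%:R).
have K0 : 0 < K by rewrite expR_gt0.
have b20 : 0 < beta / 2 by rewrite divr_gt0.
have : (hausdorff_content s 1 growth_set < (beta / 2 / K)%:E)%E.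
  apply: (@le_lt_trans _ _ 0%E); last by rewrite lte_fin divr_gt0.
  by rewrite -Hs; apply: ereal_sup_ubound; exists 1 => //=.
move=> /ereal_inf_lt[_ [U [EU _] <-]] Ubeta.
have UW i : exists W : option (seq 'I_m),
  (forall x, U i x -> exists2 w, W = Some w & word_set w x) /\
  ((if W is Some w then (expR (- ((size w)%:R * (s * ln m%:R))))%:E else 0) <=
   K%:E * hausdorff_weight s (U i) + (beta / 2 / (2 ^ i.+1)%:R)%:E)%E.
  have e0 : 0 < beta / 2 / (2 ^ i.+1)%:R by rewrite divr_gt0// ltr0n expn_gt0.
  have [U0|/set0P U0] := eqVneq (U i) set0.
    exists None; split=> [x|]; first by rewrite U0.
    by rewrite U0 /hausdorff_weight eqxx mule0 add0e lee_fin ltW.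
  have [w Uw wle] := covering_word m2 U0 s0 e0.
  by exists (Some w); split=> // x /Uw xw; exists w.
have [W WP] := choice UW.
have weight0 V : (0 <= hausdorff_weight s V)%E.
  by rewrite /hausdorff_weight; case: ifP => // _; exact: poweR_ge0.
have [|x Ex xW] := betaP W.
  apply: le_lt_trans (lee_nneseries _ (fun i _ => (WP i).2)) _.
    by move=> i _ _; case: (W i) => // w; rewrite lee_fin expR_ge0.
  apply: le_lt_trans (epsilon_trick _ _ (ltW b20)) _.
    by move=> i; rewrite mule_ge0// lee_fin ltW.
  rewrite nneseriesZl//.
  rewrite [ltRHS](_ : _ = K%:E * (beta / 2 / K)%:E + (beta / 2)%:E)%E.
    by rewrite lteD2rE// lte_pmul2l// lte_fin.
  rewrite -EFinM -EFinD; congr (_%:E); field; exact: lt0r_neq0.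
have [i _ Uix] := EU _ Ex.
by have [w Wi wx] := (WP i).1 _ Uix; case: (xW _ _ Wi wx).
Qed.

(** Every point of the growth set has, for all large [n], a prefix of length
    [n] that is not deviant, so the cylinders of the long non-deviant words
    cover it.  Their number at length [n] is at most
    [exp (n (P q - alpha q + |q| eps))] up to a constant factor, which the weight
    [exp (- n s ln m)] beats. *)
Lemma null_measure_above (s : R) : 0 <= s ->
  P q - alpha * q < s * ln m%:R -> hausdorff_measure s growth_set = 0%E.
Proof.
move=> s0 sP.
have lm0 : 0 < ln m%:R :> R by rewrite ln_gt0 ?ltr1n.
pose gap := s * ln m%:R - (P q - alpha * q).
have gap0 : 0 < gap by rewrite subr_gt0.
(* Half of the gap absorbs the tolerance, the other half is the decay rate. *)
pose eps := gap / 2 / (`|q| + 1).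
have q1 : 0 < `|q| + 1 by rewrite ltr_wpDl.
have eps0 : 0 < eps by rewrite divr_gt0// divr_gt0.
have qeps : `|q| * eps <= gap / 2.
  rewrite /eps mulrA ler_pdivrMr// mulrC ler_wpM2l ?divr_ge0 ?ltW//.
  by rewrite ltrDl.
pose good w := admissible A w && ~~ deviant eps w.
pose c w := if good w then expR (- ((size w)%:R * (s * ln m%:R))) else 0.
have c0 w : 0 <= c w by rewrite /c; case: ifP => // _; rewrite expR_ge0.
have [C hC] := hP q.
have cS n : \sum_(J : n.-tuple 'I_m) c J <= expR C * expR (- (n%:R * (gap / 2))).
  have n0 : 0 <= n%:R :> R by [].
  apply: (@le_trans _ _ (partition_sum A L q n *
    expR (n%:R * (gap / 2) - n%:R * (alpha * q) - n%:R * (s * ln m%:R)))).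
    rewrite /partition_sum mulr_suml ler_sum// => J _.
    rewrite /c /good /weight size_tuple; case: (admissible A J) => /=; last first.
      by rewrite mul0r.
    case: ifPn => [|_]; last by rewrite mulr_ge0// expR_ge0.
    rewrite /deviant -leNgt size_tuple => dev; rewrite -expRD ler_expR.
    have : `|q * (L J - n%:R * alpha)| <= n%:R * (gap / 2).
      rewrite normrM; apply: le_trans (ler_wpM2l (normr_ge0 q) dev) _.
      by rewrite [leLHS]mulrA [leLHS]mulrC ler_wpM2l.
    by rewrite ler_norml => /andP[h1 h2]; lra.
  apply: le_trans (ler_wpM2r (expR_ge0 _) (andP (hC n)).2) _.
  by rewrite -!expRD ler_expR /gap; lra.
apply/eqP; rewrite eq_le; apply/andP; split; last first.
  apply: le_trans (_ : hausdorff_content s 1 growth_set <= _)%E; last first.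
    by apply: ereal_sup_ubound; exists 1 => //=.
  apply: le_ereal_inf_tmp => _ [U _ <-]; apply: nneseries_ge0 => i _ _.
  by rewrite /hausdorff_weight; case: ifP => // _; exact: poweR_ge0.
apply: ge_ereal_sup => _ [delta /= delta0 <-]; apply/lee_addgt0Pr => eta eta0.
rewrite add0e.
have gap20 : 0 < gap / 2 by rewrite divr_gt0.
have [N1 N1P] := exponential_tail_cost gap20 eta0 c0 cS.
have [N2] := exponential_small ler01 lm0 delta0.
rewrite mul1r -expr_inv_expR// => N2P.
pose N := maxn N1 N2.
pose U i : set (fullshift R m) := if @pickle_inv (seq 'I_m) i is Some w then
  if (N <= size w)%N && good w then word_set w else set0 else set0.
have w0 : hausdorff_weight s (set0 : set (fullshift R m)) = 0%E.
  by rewrite /hausdorff_weight eqxx.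
apply: le_trans N1P; rewrite -total_cost_pickle; last first.
  by move=> w; case: ifP => // _; rewrite lee_fin.
apply: le_trans (_ : \sum_(0 <= i <oo) hausdorff_weight s (U i) <= _)%E; last first.
  apply: lee_nneseries => [i _ _|i _].
    by rewrite /hausdorff_weight; case: ifP => // _; exact: poweR_ge0.
  rewrite /U; case: pickle_inv => [w|]; last by rewrite w0.
  case: ifP => [/andP[Nw gw]|_].
    rewrite (leq_trans (leq_maxl _ _) Nw) /c gw.
    exact: weight_word_set.
  by rewrite w0; case: ifP => // _; rewrite lee_fin.
apply: ereal_inf_lbound; exists U => //; split; last first.
  move=> i; have d0 : (diam (set0 : set (fullshift R m)) <= delta%:E)%E.
    by apply: ge_ereal_sup => _ [p [[]]].
  rewrite /U; case: pickle_inv => [w|]//; case: ifP => // /andP[Nw _].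
  apply: le_trans (diam_word_set m2 w) _; rewrite lee_fin.
  apply: le_trans N2P; rewrite lef_pV2 ?posrE ?exprn_gt0 ?ltr0n ?(leq_trans _ m2)//.
  by rewrite ler_weXn2l ?ler1n ?(leq_trans _ m2)// (leq_trans (leq_maxr _ _) Nw).
move=> x [xA /cvgrPdist_le/(_ _ eps0)[N3 _ N3P]].
pose n := maxn N (maxn N3 1).
have gx : good (mkseq x n).
  rewrite /good (subshift_mkseq A x).2//= /deviant size_mkseq -leNgt.
  have n0 : 0 < n%:R :> R by rewrite ltr0n /n !leq_max !orbT.
  have Nn : (N3 <= n)%N by rewrite /n !leq_max leqnn ?orbT.
  have /= := N3P n Nn.
  rewrite -(ler_pM2r n0) -[X in _ * X <= _](gtr0_norm n0) -normrM.
  by rewrite mulrBl mulfVK ?gt_eqF// (mulrC alpha) -normrN opprB.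
exists (pickle (mkseq x n)) => //; rewrite /U pickleK_inv gx size_mkseq.
by rewrite leq_maxl /= /word_set/= size_mkseq.
Qed.

Theorem growth_set_dim :
  hausdorff_dim growth_set = ((ln m%:R)^-1 * (- alpha * q + P q))%:E.
Proof.
have lm0 : 0 < ln m%:R :> R by rewrite ln_gt0 ?ltr1n.
rewrite mulNr [- _ + _]addrC mulrC -[X in (X / _)%:E]/(P q - alpha * q).
apply/eqP; rewrite eq_le; apply/andP; split.
  apply/lee_addgt0Pr => e e0; rewrite -EFinD; apply: ereal_inf_lbound.
  have v0 : 0 <= (P q - alpha * q) / ln m%:R.
    by rewrite divr_ge0 ?(ltW lm0)// subr_ge0 entropy_ge0.
  exists ((P q - alpha * q) / ln m%:R + e) => //=.
  split; first by rewrite addr_ge0// ltW.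
  apply: null_measure_above; first by rewrite addr_ge0// ltW.
  by rewrite mulrDl mulfVK ?gt_eqF// ltrDl mulr_gt0.
apply: le_ereal_inf_tmp => _ [s [s0 Hs] <-]; rewrite lee_fin ler_pdivrMr//.
exact: null_measure_bound.
Qed.

End dimension.

(** * Products of positive matrices along the shift *)

Section extension.
Context {R : realType} {m : nat} (A : 'M[nat]_m).
Context (nxt : 'I_m -> 'I_m) (i0 : 'I_m).

(** Following [w] by successive admissible letters gives a canonical point of
    the cylinder of [w]. *)
Definition extend (w : seq 'I_m) : fullshift R m := fun k =>
  if (k < size w)%N then nth i0 w k else iter (k - size w).+1 nxt (last i0 w).

Lemma extend_word_set w : word_set w (extend w).
Proof.
apply: (@eq_from_nth _ i0); rewrite size_mkseq// => k kw.
by rewrite nth_mkseq// /extend kw.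
Qed.

Lemma extend_subshift w : (forall a, A a (nxt a) = 1%N) -> admissible A w ->
  subshift A (extend w).
Proof.
move=> nxtP Aw k; rewrite /extend.
have [kw|wk] := ltnP k.+1 (size w).
  by rewrite (ltnW kw); apply/eqP; move/(sortedP i0) : Aw; apply.
have [kw|{}wk] := ltnP k (size w).
  have kE : size w = k.+1 by apply/eqP; rewrite eqn_leq kw wk.
  by rewrite kE subnn/= -nth_last kE/=.
by rewrite subSn// iterS.
Qed.

End extension.

Lemma primitive_successor m (A : 'M[nat]_m) : zero_one_mx A -> primitive_mx A ->
  exists nxt : 'I_m -> 'I_m, forall a, A a (nxt a) = 1%N.
Proof.
move=> A01 [p [p0 Ap]]; case: p p0 Ap => // r _ Ar.
suff /choice[nxt] : forall a, exists b, A a b = 1%N by exists nxt.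
move=> a; have [w _] := positive_entry_path A01 (Ar a a).
by case: w => [|b w] /= /andP[/eqP Ab _]; [exists a|exists b].
Qed.

Section matrix_norm.
Context {R : realType} {d : nat}.
Implicit Types B C : 'M[R]_d.

Definition colsum B k := \sum_i B i k.

Lemma mxnorm_sumE B : mxnorm_sum B = \sum_k colsum B k.
Proof. by rewrite /mxnorm_sum exchange_big. Qed.

Lemma colsumM B C k : colsum (B * C) k = \sum_l colsum B l * C l k.
Proof.
rewrite /colsum.
under eq_bigr do rewrite mxE.
by rewrite exchange_big/=; apply: eq_bigr => l _; rewrite mulr_suml.
Qed.

Lemma mxnorm_sumM B C :
  mxnorm_sum (B * C) = \sum_l colsum B l * (\sum_k C l k).
Proof.
rewrite mxnorm_sumE; under eq_bigr do rewrite colsumM.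
by rewrite exchange_big/=; apply: eq_bigr => l _; rewrite mulr_sumr.
Qed.

Lemma mxnorm_sumM_le B C : (forall i j, 0 <= B i j) -> (forall i j, 0 <= C i j) ->
  mxnorm_sum (B * C) <= mxnorm_sum B * mxnorm_sum C.
Proof.
move=> B0 C0; rewrite mxnorm_sumM [mxnorm_sum C]/mxnorm_sum mulr_sumr.
apply: ler_sum => l _; rewrite ler_wpM2r ?sumr_ge0//.
rewrite mxnorm_sumE (bigD1 l)//= lerDl sumr_ge0// => k _.
by rewrite /colsum sumr_ge0.
Qed.

(** Each row of [C] is paired with a column of [B] that carries at least the
    proportion [c] of the mass of [B]. *)
Lemma mxnorm_sumM_ge B C c : (forall i j, 0 <= C i j) ->
  (forall k, c * mxnorm_sum B <= colsum B k) ->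
  c * (mxnorm_sum B * mxnorm_sum C) <= mxnorm_sum (B * C).
Proof.
move=> C0 Bc; rewrite mxnorm_sumM [mxnorm_sum C]/mxnorm_sum mulrA mulr_sumr.
by apply: ler_sum => l _; rewrite ler_wpM2r ?sumr_ge0.
Qed.

Lemma mx_entry_le_norm B i j : `|B i j| <= `|B|.
Proof.
rewrite [leRHS](_ : _ = mx_norm B)// mx_normrE.
exact: (@le_bigmax _ _ _ 0 (fun ij : 'I_d * 'I_d => `|B ij.1 ij.2|) (i, j)).
Qed.

End matrix_norm.

Section matrix_cocycle.
Context {R : realType} {m : nat} (m2 : (2 <= m)%N) (A : 'M[nat]_m).
Context (A01 : zero_one_mx A) (hA : primitive_mx A).
Context {d : nat} (d0 : (0 < d)%N) (M : fullshift R m -> 'M[R]_d).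
Context (Mpos : forall x, subshift A x -> forall i j, 0 < M x i j).
Context (Mhoelder : hoelder_continuous_on (subshift A) M).

Lemma entry_hoelder : exists C theta : R, [/\ 0 <= C, 0 < theta &
  forall n x y, subshift A x -> subshift A y ->
    (forall k, (k < n)%N -> x k = y k) ->
    forall i j, M x i j <= M y i j + C * expR (- (n%:R * theta))].
Proof.
have [C [a [a0 Ca]]] := Mhoelder.
exists `|C|, (a * ln m%:R); split=> //.
  by rewrite mulr_gt0// ln_gt0// ltr1n.
move=> n x y Ax Ay xy i j; rewrite -lerBlDl (le_trans (ler_norm _))//.
rewrite [leLHS](_ : _ = `|(M x - M y) i j|); last by rewrite !mxE.
rewrite (le_trans (mx_entry_le_norm _ _ _))// (le_trans (Ca _ _ Ax Ay))//.
apply: (@le_trans _ _ (`|C| * mdist x y `^ a)).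
  by rewrite ler_wpM2r ?powR_ge0// ler_norm.
rewrite ler_wpM2l// -expr_inv_powR//.
apply: ge0_ler_powR; first exact: ltW.
- by rewrite nnegrE mdist_ge0.
- by rewrite nnegrE invr_ge0 exprn_ge0.
- exact: dist_le_agree.
Qed.

(** Compactness by hand: if the entry had infimum 0, then one could follow,
    letter by letter, cylinders on which the infimum is 0; by continuity the
    entry would vanish at the point they converge to. *)
Lemma entry_lower_bound i j : exists2 a : R, 0 < a &
  forall x, subshift A x -> a <= M x i j.
Proof.
have [C [theta [C0 theta0 MC]]] := entry_hoelder.
pose P w := forall e : R, 0 < e ->
  exists2 x : fullshift R m, subshift A x & word_set w x /\ M x i j < e.
apply: contrapT => noa.
have [||x xP] := @infinite_branch _ P.
- move=> e e0; apply: contrapT => nox; apply: noa; exists e => // x Ax.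
  by rewrite leNgt; apply/negP => xe; apply: nox; exists x.
- move=> w Pw; apply: contrapT => /forallNP nob.
  have /choice[e eP] : forall b, exists e : R, 0 < e /\
      forall x, subshift A x -> word_set (rcons w b) x -> e <= M x i j.
    move=> b; have /existsNP[e /not_implyP[e0 ne]] := nob b.
    exists e; split=> // x Ax xb; rewrite leNgt; apply/negP => xe.
    by apply: ne; exists x.
  have e0 : 0 < \big[Num.min/1]_b e b.
    by apply: lt_bigmin => // b _; exact: (eP b).1.
  have [x Ax [xw]] := Pw _ e0; apply/negP; rewrite -leNgt.
  apply: le_trans (bigmin_le _ (x (size w)) _) _.
  apply: (eP _).2 => //.
  by rewrite /word_set/= size_rcons mkseqS xw.
have Ax : subshift A (x : fullshift R m).
  apply/subshift_mkseq => n; have [y Ay [yx _]] := xP n 1 ltr01.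
  by rewrite -yx size_mkseq; exact: (subshift_mkseq A y).2.
have e0 := Mpos Ax i j; have e20 : 0 < M x i j / 2 by rewrite divr_gt0.
have [N NP] := exponential_small C0 theta0 e20.
have [y Ay [yx yj]] := xP N _ e20.
have yx' : forall k, (k < N)%N -> x k = y k.
  by apply/mkseq_eqP; rewrite -yx size_mkseq.
have := MC N x y Ax Ay yx' i j; lra.
Qed.

Lemma entry_bounds : exists a b : R, [/\ 0 < a, a <= b &
  forall x, subshift A x -> forall i j, a <= M x i j <= b].
Proof.
have /choice[a aP] : forall p : 'I_d * 'I_d, exists a : R, 0 < a /\
    forall x, subshift A x -> a <= M x p.1 p.2.
  by move=> p; have [a a0 aM] := entry_lower_bound p.1 p.2; exists a.
have [nxt nxtP] := primitive_successor A01 hA.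
have i0 : 'I_m by exists 0%N; exact: leq_trans m2.
pose x0 : fullshift R m := extend nxt i0 [::].
have Ax0 : subshift A x0 by exact: extend_subshift.
have [C [theta [C0 theta0 MC]]] := entry_hoelder.
pose a' := \big[Num.min/1]_p a p; pose b := \sum_i \sum_j M x0 i j + C.
have bP x : subshift A x -> forall i j, M x i j <= b.
  move=> Ax i j; have := MC 0%N x x0 Ax Ax0 ltac:(by []) i j.
  rewrite mul0r oppr0 expR0 mulr1 => /le_trans; apply; rewrite lerD2r.
  have pos k l : 0 <= M x0 k l by rewrite ltW// Mpos.
  rewrite (bigD1 i)//= (bigD1 j)//= -addrA lerDl addr_ge0 ?sumr_ge0// => k _.
  by rewrite sumr_ge0.
have aP' x : subshift A x -> forall i j, a' <= M x i j.
  move=> Ax i j; apply: le_trans (bigmin_le _ (i, j) a) _.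
  exact: (aP (i, j)).2.
exists a', b; split=> [||x Ax i j].
- by apply: lt_bigmin => // p _; exact: (aP p).1.
- have j0 : 'I_d by exists 0%N.
  exact: le_trans (aP' _ Ax0 j0 j0) (bP _ Ax0 j0 j0).
- by rewrite aP'// bP.
Qed.

Lemma subshift_iter (x : fullshift R m) n :
  subshift A x -> subshift A (iter n Defs.shift x).
Proof. by move=> Ax; elim: n => // n ih k /=; exact: ih. Qed.

Lemma iter_shiftE (x : fullshift R m) n k : iter n Defs.shift x k = x (n + k)%N.
Proof. by elim: n k => // n ih k; rewrite iterS /Defs.shift ih addnS addSn. Qed.

Lemma cocycle0 x : cocycle M 0 x = 1.
Proof. by rewrite /cocycle big_ord0. Qed.

Lemma cocycleSr n x : cocycle M n.+1 x = cocycle M n x * M (iter n Defs.shift x).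
Proof. by rewrite /cocycle big_ord_recr. Qed.

Lemma cocycleD n k x :
  cocycle M (n + k) x = cocycle M n x * cocycle M k (iter n Defs.shift x).
Proof.
elim: k => [|k ih]; first by rewrite addn0 cocycle0 mulr1.
by rewrite addnS !cocycleSr ih mulrA -iterD addnC.
Qed.

Lemma cocycleS n x : cocycle M n.+1 x = M x * cocycle M n (Defs.shift x).
Proof. by rewrite -add1n cocycleD cocycleSr cocycle0 mul1r. Qed.

Lemma cocycle_ge0 n x : subshift A x -> forall i j, 0 <= cocycle M n x i j.
Proof.
elim: n x => [|n ih] x Ax i j; first by rewrite cocycle0 mxE ler0n.
rewrite cocycleS mxE sumr_ge0// => k _.
by rewrite mulr_ge0 ?ih ?(ltW (Mpos Ax _ _))//; exact: (subshift_iter 1 Ax).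
Qed.

(** At step [k] the points agree on their first [n - k] coordinates, so by the
    Hoelder condition and the lower bound on the entries the matrices there
    differ by a factor at most [exp (C / a * exp (- (n - k) theta))]; the
    exponents form a convergent geometric series. *)
Lemma distortion : exists kappa : R, forall n x y,
  subshift A x -> subshift A y -> (forall k, (k < n)%N -> x k = y k) ->
  mxnorm_sum (cocycle M n x) <= expR kappa * mxnorm_sum (cocycle M n y).
Proof.
have [C [theta [C0 theta0 MC]]] := entry_hoelder.
have [a [b [a0 _ abP]]] := entry_bounds.
pose s n := \sum_(k < n) expR (- (k%:R * theta)).
have Ca0 : 0 <= C / a by rewrite divr_ge0// ltW.
have step n x y : subshift A x -> subshift A y ->
    (forall k, (k < n)%N -> x k = y k) ->
    forall i j, M x i j <= expR (C / a * expR (- (n%:R * theta))) * M y i j.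
  move=> Ax Ay xy i j; rewrite (le_trans (MC n _ _ Ax Ay xy i j))//.
  have /andP[ay _] := abP _ Ay i j.
  apply: (@le_trans _ _ ((1 + C / a * expR (- (n%:R * theta))) * M y i j)).
    rewrite mulrDl mul1r lerD2l mulrAC ler_wpM2r ?expR_ge0//.
    by rewrite mulrAC ler_pdivlMr// ler_wpM2l.
  by rewrite ler_wpM2r ?expR_ge1Dx// ltW// Mpos.
have main n x y : subshift A x -> subshift A y ->
    (forall k, (k < n)%N -> x k = y k) ->
    forall i j, cocycle M n x i j <= expR (C / a * s n) * cocycle M n y i j.
  elim: n x y => [|n ih] x y Ax Ay xy i j.
    by rewrite !cocycle0 /s big_ord0 mulr0 expR0 mul1r.
  have Ax1 := subshift_iter 1 Ax; have Ay1 := subshift_iter 1 Ay.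
  rewrite !cocycleS !mxE mulr_sumr ler_sum// => k _.
  rewrite /s big_ord_recr/= mulrDr expRD -/(s n) (mulrC (expR (C / a * s n))).
  rewrite mulrACA; apply: ler_pM.
  - exact/ltW/Mpos.
  - exact: cocycle_ge0.
  - by apply: step => // l ln; apply: xy; exact: ltnW.
  - by apply: ih => // l ln; exact: xy.
have [S sS] : exists S, forall n, s n <= S.
  have [N NP] := geometric_tail ler01 theta0 ltr01.
  exists (s N + 1) => n; rewrite -lerBlDl.
  have [nN|/ltnW Nn] := leqP n N.
    rewrite (@le_trans _ _ 0)// subr_le0 /s -(subnKC nN) big_split_ord/=.
    by rewrite lerDl sumr_ge0// => k _; exact: expR_ge0.
  rewrite -lee_fin; apply: le_trans NP.
  rewrite /s -!(big_mkord xpredT (fun k => expR (- (k%:R * theta)))).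
  rewrite (big_cat_nat _ Nn)//= addrAC subrr add0r -sumEFin.
  under eq_bigr do rewrite -[expR _]mul1r.
  by apply: nneseries_lim_ge => k _ _; rewrite lee_fin mul1r expR_ge0.
exists (C / a * S) => n x y Ax Ay xy.
rewrite /mxnorm_sum mulr_sumr ler_sum// => i _.
rewrite mulr_sumr ler_sum// => j _; apply: le_trans (main n x y Ax Ay xy i j) _.
by rewrite ler_wpM2r ?cocycle_ge0// ler_expR ler_wpM2l.
Qed.

(** The last factor, whose entries lie between [a] and [b], mixes the columns:
    every column sum of [B * M x'] lies between [a] and [b] times the norm of
    [B], so each is at least the proportion [a / (d * b)] of their total.
    The empty product is covered by the same constant, as [a <= b]. *)
Lemma colsum_cocycle : exists2 c : R, 0 < c & forall n x k, subshift A x ->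
  c * mxnorm_sum (cocycle M n x) <= colsum (cocycle M n x) k.
Proof.
have [a [b [a0 ab abP]]] := entry_bounds.
have b0 : 0 < b by exact: lt_le_trans ab.
have dR : 0 < d%:R :> R by rewrite ltr0n.
exists (a / (d%:R * b)); first by rewrite divr_gt0// mulr_gt0.
move=> n x k Ax; rewrite mulrAC ler_pdivrMr ?mulr_gt0//.
have col1 l : colsum (1 : 'M[R]_d) l = 1.
  rewrite /colsum (bigD1 l)//= mxE eqxx big1 ?addr0// => i /negbTE.
  by rewrite mxE => ->.
case: n => [|n].
  rewrite cocycle0 mxnorm_sumE; under eq_bigr do rewrite col1.
  rewrite col1 mul1r sumr_const card_ord mulrC -mulr_natr mul1r.
  by rewrite ler_wpM2l// ltW.
rewrite cocycleSr; set B := cocycle M n x; set x' := iter n Defs.shift x.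
have Ax' : subshift A x' by exact: subshift_iter.
have B0 l : 0 <= colsum B l by rewrite sumr_ge0// => i _; exact: cocycle_ge0.
have low : a * mxnorm_sum B <= colsum (B * M x') k.
  rewrite colsumM mxnorm_sumE mulr_sumr ler_sum// => l _.
  by rewrite mulrC ler_wpM2l//; have /andP[] := abP _ Ax' l k.
have upp : mxnorm_sum (B * M x') <= mxnorm_sum B * (d%:R * b).
  rewrite mxnorm_sumM mxnorm_sumE mulr_suml ler_sum// => l _.
  rewrite ler_wpM2l// mulr_natl -[leRHS](_ : \sum_(k < d) b = _); last first.
    by rewrite sumr_const card_ord.
  by apply: ler_sum => j _; have /andP[] := abP _ Ax' l j.
have db0 : 0 <= d%:R * b by rewrite mulr_ge0// ltW.
apply: le_trans (ler_wpM2l (ltW a0) upp) _.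
by rewrite [leLHS]mulrA ler_wpM2r.
Qed.

Lemma cocycle_norm_gt0 n x : subshift A x -> 0 < mxnorm_sum (cocycle M n x).
Proof.
move=> Ax.
have dR : 0 < d%:R :> R by rewrite ltr0n.
have [a [b [a0 _ abP]]] := entry_bounds.
elim: n => [|n ih].
  rewrite cocycle0 /mxnorm_sum.
  under eq_bigr => i _.
    rewrite (bigD1 i)//= mxE eqxx big1 ?addr0; last first.
      by move=> j /negbTE ji; rewrite mxE eq_sym ji.
    over.
  by rewrite sumr_const card_ord.
apply: (@lt_le_trans _ _ (mxnorm_sum (cocycle M n x) * (d%:R * a))).
  by rewrite !mulr_gt0.
rewrite cocycleSr mxnorm_sumM mxnorm_sumE mulr_suml ler_sum// => l _.
rewrite ler_wpM2l ?sumr_ge0//; first by move=> i _; exact: cocycle_ge0.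
rewrite mulr_natl -[leLHS](_ : \sum_(k < d) a = _); last first.
  by rewrite sumr_const card_ord.
by apply: ler_sum => j _; have /andP[] := abP _ (subshift_iter n Ax) l j.
Qed.

Lemma cocycle_quasi_multiplicative : exists kappa : R, forall n k x,
  subshift A x ->
  `|ln (mxnorm_sum (cocycle M (n + k) x)) - ln (mxnorm_sum (cocycle M n x)) -
    ln (mxnorm_sum (cocycle M k (iter n Defs.shift x)))| <= kappa.
Proof.
have [c c0 cP] := colsum_cocycle.
exists `|ln c| => n k x Ax; have Ay := subshift_iter n Ax.
have X0 := cocycle_norm_gt0 n Ax; have Y0 := cocycle_norm_gt0 k Ay.
have Z0 := cocycle_norm_gt0 (n + k) Ax.
have := mxnorm_sumM_le (cocycle_ge0 n Ax) (cocycle_ge0 k Ay).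
have := mxnorm_sumM_ge (cocycle_ge0 k Ay) (fun l => cP n x l Ax).
rewrite -cocycleD => h1 h2.
have {}h1 : ln c + (ln (mxnorm_sum (cocycle M n x)) +
    ln (mxnorm_sum (cocycle M k (iter n Defs.shift x)))) <=
    ln (mxnorm_sum (cocycle M (n + k) x)).
  by rewrite -!lnM ?ler_ln ?posrE ?mulr_gt0.
have {}h2 : ln (mxnorm_sum (cocycle M (n + k) x)) <=
    ln (mxnorm_sum (cocycle M n x)) +
    ln (mxnorm_sum (cocycle M k (iter n Defs.shift x))).
  by rewrite -!lnM ?ler_ln ?posrE ?mulr_gt0.
have := ler_norm (- ln c); rewrite normrN => h3.
by have := normr_ge0 (ln c); rewrite ler_norml => h4; apply/andP; split; lra.
Qed.

(** The function [L] on words is the logarithm of the norm at the canonical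
    point of the cylinder; by distortion any other point gives the same value up
    to a constant. *)
Lemma cocycle_potential : exists (L : seq 'I_m -> R) (kappa kappa' : R),
  [/\ almost_additive_potential A L kappa,
      forall w x, subshift A x -> word_set w x ->
        `|ln (mxnorm_sum (cocycle M (size w) x)) - L w| <= kappa' &
      forall w, admissible A w -> exists2 x, subshift A x & word_set w x /\
        L w = ln (mxnorm_sum (cocycle M (size w) x))].
Proof.
have [nxt nxtP] := primitive_successor A01 hA.
have i0 : 'I_m by exists 0%N; exact: leq_trans m2.
pose L w := ln (mxnorm_sum (cocycle M (size w) (extend nxt i0 w))).
have [k1 k1P] := distortion; have [k2 k2P] := cocycle_quasi_multiplicative.
have LP w x : subshift A x -> word_set w x ->
    `|ln (mxnorm_sum (cocycle M (size w) x)) - L w| <= k1.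
  move=> Ax xw; set y : fullshift R m := extend nxt i0 w.
  have Ay : subshift A y.
    by apply: extend_subshift => //; rewrite -xw; exact: (subshift_mkseq A x).2.
  have yw : word_set w y by exact: extend_word_set.
  have xy : forall k, (k < size w)%N -> x k = y k by apply/mkseq_eqP; rewrite xw yw.
  have lnle u v : subshift A u -> subshift A v ->
      (forall k, (k < size w)%N -> u k = v k) ->
      ln (mxnorm_sum (cocycle M (size w) u)) <=
      k1 + ln (mxnorm_sum (cocycle M (size w) v)).
    move=> Au Av uv; have u0 := cocycle_norm_gt0 (size w) Au.
    have v0 := cocycle_norm_gt0 (size w) Av.
    rewrite -[X in _ <= X + _]expRK -lnM ?posrE ?expR_gt0//.
    by rewrite ler_ln ?posrE ?mulr_gt0 ?expR_gt0// k1P.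
  have h1 := lnle x y Ax Ay xy.
  have h2 := lnle y x Ay Ax (fun k kw => esym (xy k kw)).
  by rewrite ler_norml /L -/y; apply/andP; split; lra.
exists L, (k2 + 2 * k1), k1; split=> // [u v uv|w Aw]; last first.
  exists (extend nxt i0 w); first exact: extend_subshift.
  by split=> //; exact: extend_word_set.
set x : fullshift R m := extend nxt i0 (u ++ v).
have Ax : subshift A x by exact: extend_subshift.
have xuv : mkseq x (size u + size v) = u ++ v.
  by rewrite -size_cat; exact: extend_word_set.
have xu : word_set u x.
  rewrite /word_set/= -[RHS](take_size_cat v (erefl (size u))) -xuv.
  by rewrite /mkseq -map_take take_iota (minn_idPl _) ?leq_addr.
have xv : word_set v (iter (size u) Defs.shift x).
  rewrite /word_set/= -[RHS](drop_size_cat v (erefl (size u))) -xuv.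
  rewrite /mkseq -map_drop drop_iota add0n addKn -[size u in RHS]addn0 iotaDl.
  by rewrite -map_comp; apply: eq_map => k /=; rewrite iter_shiftE.
have h1 := LP _ _ Ax xu; have h2 := LP _ _ (subshift_iter (size u) Ax) xv.
have h3 := k2P (size u) (size v) x Ax.
rewrite [L (u ++ v)]/L size_cat -/x.
move: h1 h2 h3; rewrite !ler_norml => /andP[h1 h2] /andP[h3 h4] /andP[h5 h6].
by apply/andP; split; lra.
Qed.

End matrix_cocycle.

(** * Pressure and level sets of the cocycle *)

Section comparison.
Context {R : realType} {m d : nat} (A : 'M[nat]_m) (M : fullshift R m -> 'M[R]_d).
Context (L : seq 'I_m -> R) (kappa : R).
Context (Mgt0 : forall n x, subshift A x -> 0 < mxnorm_sum (cocycle M n x)).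
Context (LM : forall w x, subshift A x -> word_set w x ->
  `|ln (mxnorm_sum (cocycle M (size w) x)) - L w| <= kappa).
Context (Lpt : forall w, admissible A w -> exists2 x, subshift A x &
  word_set w x /\ L w = ln (mxnorm_sum (cocycle M (size w) x))).

Lemma level_set_growth alpha : level_set A M alpha = growth_set A L alpha.
Proof.
have close x : subshift A x -> ln (mxnorm_sum (cocycle M n x)) / n%:R -
    L (mkseq x n) / n%:R @[n --> \oo] --> (0 : R).
  move=> Ax; apply/cvgrPdist_le => e e0.
  move/cvgrPdist_le : (@cst_div_cvg0 R kappa) => /(_ e e0).
  apply: filterS => n /=; rewrite !sub0r !normrN -mulrBl => /(le_trans _); apply.
  rewrite !normrM ler_wpM2r// (le_trans _ (ler_norm _))//.
  have xn : word_set (mkseq x n) x by rewrite /word_set/= size_mkseq.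
  by have := LM Ax xn; rewrite size_mkseq.
apply/seteqP; split=> x [Ax cx]; split=> //.
  rewrite -[alpha]subr0 (_ : (fun n => L (mkseq x n) / n%:R) = fun n =>
    ln (mxnorm_sum (cocycle M n x)) / n%:R -
    (ln (mxnorm_sum (cocycle M n x)) / n%:R - L (mkseq x n) / n%:R)).
    by apply: cvgB => //; exact: close.
  by apply/funext => n; rewrite opprB addrC subrK.
rewrite -[alpha]add0r (_ : (fun n => ln (mxnorm_sum (cocycle M n x)) / n%:R) =
  fun n => ln (mxnorm_sum (cocycle M n x)) / n%:R - L (mkseq x n) / n%:R +
           L (mkseq x n) / n%:R).
  by apply: cvgD => //; exact: close.
by apply/funext => n; rewrite subrK.
Qed.

(** By distortion the supremum over a cylinder differs by a bounded factor
    from the weight of the word, and a bounded factor does not change the growth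
    rate. *)
Lemma pressureE t P C :
  (forall n, expR (n%:R * P - C) <= partition_sum A L t n <= expR (n%:R * P + C)) ->
  pressure A M t = P.
Proof.
move=> SP; rewrite /pressure; apply/cvg_lim => //.
pose Z n := \sum_(J : n.-tuple 'I_m | admissible A J)
  sup [set mxnorm_sum (cocycle M n x) `^ t | x in cylinder A J].
rewrite -/(Z _).
have ZP n (J : n.-tuple 'I_m) : admissible A J ->
    expR (t * L J) <= sup [set mxnorm_sum (cocycle M n x) `^ t | x in cylinder A J]
      <= expR (`|t| * kappa) * expR (t * L J).
  move=> AJ; set S := [set _ | _ in _].
  have powE x : subshift A x -> mxnorm_sum (cocycle M n x) `^ t =
      expR (t * ln (mxnorm_sum (cocycle M n x))).
    by move=> Ax; rewrite /powR gt_eqF// Mgt0.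
  have [x Ax [xJ LJ]] := Lpt AJ; rewrite size_tuple in LJ.
  have Sx : S (expR (t * L J)).
    exists x; last by rewrite powE// LJ.
    split=> // i; rewrite (tnth_nth (x 0%N)) -[in RHS]xJ nth_mkseq//.
    by rewrite size_tuple.
  have Sub : ubound S (expR (`|t| * kappa) * expR (t * L J)).
    move=> _ [y [Ay yJ] <-]; rewrite powE// -expRD ler_expR.
    have yJ' : word_set J y.
      apply: (@eq_from_nth _ (y 0%N)); rewrite size_mkseq// => k kn.
      rewrite nth_mkseq//; rewrite size_tuple in kn.
      by rewrite (yJ (Ordinal kn)) (tnth_nth (y 0%N)).
    have := ler_wpM2l (normr_ge0 t) (LM Ay yJ'); rewrite size_tuple -normrM.
    by move=> /(le_trans (ler_norm _)); lra.
  rewrite (ub_le_sup _ Sx); last by exists (expR (`|t| * kappa) * expR (t * L J)).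
  by apply: ge_sup => //; exists (expR (t * L J)).
have SE n : partition_sum A L t n =
    \sum_(J : n.-tuple 'I_m | admissible A J) expR (t * L J).
  by rewrite /partition_sum [RHS]big_mkcond.
have Zlow n : partition_sum A L t n <= Z n.
  by rewrite SE /Z ler_sum// => J /ZP/andP[].
have Zupp n : Z n <= expR (`|t| * kappa) * partition_sum A L t n.
  by rewrite SE /Z mulr_sumr ler_sum// => J /ZP/andP[].
have lnZ n : `|ln (Z n) - n%:R * P| <= `|C| + `| `|t| * kappa|.
  have /andP[S1 S2] := SP n.
  have Zl := le_trans S1 (Zlow n).
  have Zu := le_trans (Zupp n) (ler_wpM2l (expR_ge0 _) S2).
  have Z0 : 0 < Z n by apply: lt_le_trans Zl; exact: expR_gt0.
  rewrite -expRD -[X in X <= _]lnK ?posrE// ler_expR in Zu.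
  rewrite -[X in _ <= X]lnK ?posrE// ler_expR in Zl.
  have := ler_norm C; have := ler_norm (`|t| * kappa).
  have := normr_ge0 C; have := normr_ge0 (`|t| * kappa).
  by rewrite ler_norml; move=> h1 h2 h3 h4; apply/andP; split; lra.
apply/cvgrPdist_le => e e0.
move/cvgrPdist_le : (@cst_div_cvg0 R (`|C| + `| `|t| * kappa|)) => /(_ e e0).
move=> [N _ NP]; exists (maxn N 1) => //= n /=; rewrite geq_max => /andP[Nn n1].
have n0 : 0 < n%:R :> R by rewrite ltr0n.
apply: le_trans (NP n Nn); rewrite sub0r normrN [leRHS]normrM normfV (gtr0_norm n0).
rewrite ler_pdivlMr// -[X in _ * X](gtr0_norm n0) -normrM mulrBl.
rewrite mulrAC mulVf ?gt_eqF//.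
rewrite mul1r -normrN opprB (mulrC P) (le_trans (lnZ n))//; exact: ler_norm.
Qed.

End comparison.

Theorem theorem1p3 (R : realType) (m : nat) (hm : (2 <= m)%N)
    (A : 'M[nat]_m) (hA01 : zero_one_mx A) (hA : primitive_mx A)
    (d : nat) (hd : (0 < d)%N)
    (M : fullshift R m -> 'M[R]_d)
    (hMpos : forall x, subshift A x -> forall i j, 0 < M x i j)
    (hMhoelder : hoelder_continuous_on (subshift A) M)
    (q alpha : R) (hq : q != 0)
    (halpha : is_derive q 1 (pressure A M) alpha) :
  hausdorff_dim (level_set A M alpha) =
    ((ln m%:R)^-1 * (- alpha * q + pressure A M q))%:E.
Proof.
have [L [k1 [k2 [hL LM Lpt]]]] := cocycle_potential hm hA01 hA hd hMpos hMhoelder.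
have Mgt0 n x (Ax : subshift A x) :=
  cocycle_norm_gt0 hm hA01 hA hd hMpos hMhoelder n Ax.
have i0 : 'I_m by exists 0%N; exact: leq_trans hm.
rewrite (level_set_growth LM).
have hP t : exists C, forall n, expR (n%:R * pressure A M t - C) <=
    partition_sum A L t n <= expR (n%:R * pressure A M t + C).
  have [P [C SP]] := partition_sum_growth hL hA01 hA i0 t.
  by exists C; rewrite (pressureE Mgt0 LM Lpt SP).
exact: (growth_set_dim hm hL hP halpha).
Qed.
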